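(* If $K=\mathbb{Q}(\sqrt{p_1},\sqrt{p_2})$ where $p_1,p_2$ are distinct primes with $p_1\equiv p_2\equiv 3\pmod 4$, then the log-unit lattice of $K$ is not orthogonal.
   Context: For a totally real number field $F$ of degree $n$ with real embeddings $\phi_1,\dots,\phi_n$, define $\mathrm{Log}:F^\times\to\mathbb{R}^n$ by $\mathrm{Log}(x)=(\log|\phi_1(x)|,\dots,\log|\phi_n(x)|)$. The log-unit lattice of $F$ is $\Lambda_F=\mathrm{Log}(\mathcal{O}_F^\times)$. A lattice in $\mathbb{R}^n$ is called orthogonal if it has a basis of pairwise orthogonal vectors with respect to the standard Euclidean inner product. *)

(* Defs.v *)
From HB Require Import structures.
From mathcomp Require Import all_boot all_order all_algebra all_field.
From mathcomp Require Import all_classical all_reals all_analysis.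

Set Implicit Arguments.
Unset Strict Implicit.
Unset Printing Implicit Defensive.

Import Order.TTheory GRing.Theory Num.Theory.

Local Open Scope classical_set_scope.
Local Open Scope ring_scope.

Definition ring_of_integers (F : fieldExtType rat) : set F :=
  [set x | integralOver (intr : int -> F) x].

Definition integer_units (F : fieldExtType rat) : set F :=
  [set x | ring_of_integers x /\ exists2 y, ring_of_integers y & x * y = 1].

(* Since the indices range over 'I_n with n = [F : Q], a bijective enumeration
   of the real embeddings exists exactly when F is totally real. *)
Definition real_embeddings (R : realType) (F : fieldExtType rat)
    (phi : 'I_(\dim {:F}) -> {rmorphism F -> R}) : Prop :=
  (forall i j, phi i =1 phi j -> i = j) /\
  (forall f : {rmorphism F -> R}, exists i, phi i =1 f).

Definition Log (R : realType) (F : fieldExtType rat) (n : nat)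
    (phi : 'I_n -> {rmorphism F -> R}) (x : F) : 'rV[R]_n :=
  \row_i ln `|phi i x|.

Definition log_unit_lattice (R : realType) (F : fieldExtType rat) (n : nat)
    (phi : 'I_n -> {rmorphism F -> R}) : set 'rV[R]_n :=
  [set Log phi u | u in @integer_units F].

Definition dot (R : realType) (n : nat) (u v : 'rV[R]_n) : R :=
  \sum_(i < n) u 0 i * v 0 i.

(* The rows of B are the basis vectors; the rank m may be smaller than n. *)
Definition lattice_basis (R : realType) (n m : nat) (L : set 'rV[R]_n)
    (B : 'M[R]_(m, n)) : Prop :=
  row_free B /\
  L = [set v | exists c : 'I_m -> int, v = \sum_(i < m) (c i)%:~R *: row i B].

Definition orthogonal_lattice (R : realType) (n : nat) (L : set 'rV[R]_n)
    : Prop :=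
  exists m : nat, exists2 B : 'M[R]_(m, n), lattice_basis L B &
    forall i j : 'I_m, i != j -> dot (row i B) (row j B) = 0.

(* Main.v *)
Require Import Defs.
From mathcomp Require Import all_boot all_order all_algebra all_field.
From mathcomp Require Import all_classical all_reals all_analysis.
From mathcomp Require Import zify ring lra.

Set Implicit Arguments.
Unset Strict Implicit.
Unset Printing Implicit Defensive.

Import Order.TTheory GRing.Theory Num.Theory.

Local Open Scope ring_scope.

(** Write [k_i = Q(sqrt p_i)] and let [eps_i > 1] be the fundamental unit of
    [Z[sqrt p_i]].  The sign characters of the Galois group give orthogonal
    coordinates [A_1, A_2, A_3] on the trace-zero hyperplane, and [A_i (Log u)]
    for [i = 1, 2] is the logarithm of the relative norm of [u] to [k_i], hence
    an integer multiple [a_i] of [ln eps_i].  Comparing the coefficients of [u]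
    modulo 2 shows that [a_1] and [a_2] have the same parity.  As [p_i = 3 mod 4],
    [2 * eps_i] is a square [alpha_i ^ 2] in [k_i], so [alpha_1 * alpha_2 / 2] and
    its conjugate over [k_1] are units, with coordinates
    [(ln eps_1, +- ln eps_2, 0)].  By the parity condition these two vectors are
    not sums of two nonzero orthogonal lattice vectors, so in an orthogonal
    lattice each would be a multiple of a basis vector; but they are neither
    parallel nor orthogonal, because [eps_1 <> eps_2].  No unit of
    [Q(sqrt (p_1 p_2))] is needed. *)

(** * Pell's equation *)

(** Pigeonhole: among the fractional parts of [i * r] for [0 <= i <= N], two lie in the same of the
    [N] boxes of width [1 / N], and the difference of their indices is the denominator. *)
Lemma dirichlet_approximation (R : realType) (r : R) (N : nat) : (0 < N)%N ->
  exists x y : int, [/\ 0 < y, y <= N%:Z & `|x%:~R - y%:~R * r| * N%:R < 1].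
Proof.
case: N => // N _.
pose t (i : nat) : R := i%:R * r.
pose fr i : R := t i - (Num.floor (t i))%:~R.
have fr_ge0 i : 0 <= fr i by rewrite subr_ge0 floor_le_tmp.
have fr_lt1 i : fr i < 1.
  by have := floorD1_gt (t i); rewrite intrD /fr; lra.
pose f (i : 'I_N.+2) : 'I_N.+1 := inord (Num.truncn (fr i * N.+1%:R)).
have /injectivePn[i [j nij eqf]] : ~~ injectiveb f.
  by apply/negP => /injectiveP /leq_card; rewrite !card_ord ltnn.
wlog ltij : i j nij eqf / (i < j)%N.
  move=> W; have [|lt|eq] := ltngtP i j; first exact: W.
    by apply: (W j i) => //; rewrite eq_sym.
  by move/val_inj: eq nij => ->; rewrite eqxx.
have trE k : [/\ (f k)%:R <= fr k * N.+1%:R & fr k * N.+1%:R < (f k)%:R + 1].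
  have ge0 : 0 <= fr k * N.+1%:R by rewrite mulr_ge0.
  have := truncn_itv ge0; rewrite /f inordK.
    by move/andP => [le lt]; split; rewrite ?natr1.
  by rewrite truncn_lt_nat // gtr_pMl ?ltr0n ?fr_lt1.
exists (Num.floor (t j) - Num.floor (t i)), (j%:Z - i%:Z); split.
- by lia.
- by have := ltn_ord j; lia.
have [i1 i2] := trE i; have [j1 j2] := trE j; rewrite -eqf in j1 j2.
rewrite -[N.+1%:R]ger0_norm ?ler0n// -normrM.
have -> : ((Num.floor (t j) - Num.floor (t i))%:~R - (j%:Z - i%:Z)%:~R * r) * N.+1%:R
   = fr i * N.+1%:R - fr j * N.+1%:R.
  rewrite !intrB /fr /t; ring.
by rewrite ltr_norml; apply/andP; split; lra.
Qed.

(* Pigeonhole: two Dirichlet approximations of the same norm [n], congruent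
   modulo [n], have a quotient of norm 1 in [Z[sqrt d]]. *)
Lemma pell_solution (R : realType) (d : nat) :
    (forall x y : int, x ^+ 2 = d%:Z * y ^+ 2 -> y = 0) ->
  exists x y : int, y <> 0 /\ x ^+ 2 - d%:Z * y ^+ 2 = 1.
Proof.
move=> nsq.
pose r : R := Num.sqrt d%:R.
have r2 : r ^+ 2 = d%:R by rewrite sqr_sqrtr ?ler0n.
have r_ge0 : 0 <= r by apply: sqrtr_ge0.
pose v (z : int * int) : R := `|z.1%:~R - z.2%:~R * r|.
pose nm (z : int * int) : int := z.1 ^+ 2 - d%:Z * z.2 ^+ 2.
(* If [v z <= 1], [v z * N < 1] and [0 < z.2 <= N], then [|nm z| <= v z * (v z + 2 * N * r) <= 1 + 2
   * r], a bound independent of [N]. *)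
pose M := (Num.truncn (2 * r + 1)).+1.
have M_gt : 2 * r + 1 < M%:R by rewrite truncnS_gt.
pose good z := [/\ 0 < z.2, 0 < v z & `|nm z| <= M%:Z].
have nmE z : (nm z)%:~R = (z.1%:~R - z.2%:~R * r) * (z.1%:~R + z.2%:~R * r) :> R.
  have -> : (z.1%:~R - z.2%:~R * r) * (z.1%:~R + z.2%:~R * r)
    = z.1%:~R ^+ 2 - r ^+ 2 * z.2%:~R ^+ 2 by ring.
  by rewrite r2 /nm intrB intrM !rmorphXn /=.
have nm_neq0 z : z.2 <> 0 -> nm z <> 0.
  by move=> z2 /eqP; rewrite subr_eq0 => /eqP /nsq.
have approx (e : R) : 0 < e -> exists z, good z /\ v z < e.
  move=> e0; pose N := (Num.truncn e^-1).+1.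
  have Ne : e^-1 < N%:R by rewrite truncnS_gt.
  have N0 : (0 : R) < N%:R by rewrite ltr0n.
  have N1 : (1 : R) <= N%:R by rewrite ler1n.
  have [//|x [y [y0 yN xy]]] := @dirichlet_approximation R r N.
  have y0' : (0 : R) < y%:~R by rewrite ltr0z.
  have yN' : y%:~R <= N%:R :> R by rewrite -[N%:R]/(N%:Z%:~R) ler_int.
  exists (x, y).
  have vN : v (x, y) * N%:R < 1 by [].
  have v0 : 0 <= v (x, y) by apply: normr_ge0.
  have vlt : v (x, y) < e.
    rewrite -(ltr_pM2r N0); apply: (lt_trans vN).
    by rewrite mulrC -ltr_pdivrMr // div1r.
  split=> //; split => //.
    rewrite lt_neqAle v0 andbT eq_sym normr_eq0.
    apply/negP => /eqP h0; apply: (@nm_neq0 (x, y)) => /=.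
      by move=> h; rewrite h in y0.
    by apply/eqP; rewrite -(@intr_eq0 R) nmE /= h0 mul0r.
  rewrite -(ler_int R) -[(M%:Z)%:~R]/(M%:R : R) intr_norm nmE normrM -/(v (x,y)) /=.
  have h1 : `|x%:~R + y%:~R * r| <= v (x, y) + 2 * (N%:R * r).
    have -> : x%:~R + y%:~R * r = (x%:~R - y%:~R * r) + 2 * (y%:~R * r) by ring.
    apply: (le_trans (ler_normD _ _)); rewrite lerD2l ger0_norm.
      by rewrite ler_pM2l ?ltr0n// ler_wpM2r.
    by rewrite !mulr_ge0 // ltW.
  have h2 : v (x, y) * `|x%:~R + y%:~R * r| <= v (x, y) * (v (x, y) + 2 * (N%:R * r)).
    by rewrite ler_wpM2l.
  apply: (le_trans h2).
  have v1 : v (x, y) <= 1 by nra.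
  nra.
have [z0 [z0g _]] := approx 1 ltr01.
(* Iterating [nxt] yields infinitely many good pairs, told apart by the strict decrease of [v]. *)
have /choice[nxt nxtP] : forall z, exists w, good z -> good w /\ v w < v z.
  move=> z; have [g|ng] := pselect (good z); last by exists z.
  by have [_ vz0 _] := g; have [w] := approx _ vz0; exists w.
pose s n := iter n nxt z0.
have sg n : good (s n) by elim: n => // n IH; case: (nxtP _ IH).
have slt m k : v (s (m + k).+1) < v (s m).
  elim: k => [|k IH]; first by rewrite addn0; case: (nxtP _ (sg m)).
  by rewrite addnS; apply: lt_trans IH; case: (nxtP _ (sg (m + k).+1)).
pose T := ('I_(2 * M).+1 * 'I_M.+1 * 'I_M.+1)%type.
(* The norm lies in [[-M, M]], so it is shifted by [M] to index ['I_(2 * M).+1]; residues modulo the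
   norm are at most [M]. *)
pose key z : T := (inord (absz (nm z + M%:Z)), inord (absz (z.1 %% nm z)%Z),
                   inord (absz (z.2 %% nm z)%Z)).
have /injectivePn[i [j nij]] :
    ~~ injectiveb (fun i : 'I_(#|{: T}|.+1) => key (s i)).
  by apply/negP => /injectiveP /leq_card; rewrite card_ord ltnn.
wlog ltij : i j nij / (i < j)%N.
  move=> W; have [|lt|eq] := ltngtP i j; first exact: W.
    by move=> /esym; apply: W => //; rewrite eq_sym.
  by move/val_inj: eq nij => ->; rewrite eqxx.
have vij : v (s j) < v (s i).
  by have := slt i (j - i.+1)%N; rewrite -addnS subnSK // subnKC // ltnW.
have [yi0 _ Mi] := sg i; have [yj0 _ Mj] := sg j.
have ni0 : nm (s i) <> 0 by apply: nm_neq0 => h; rewrite h ltxx in yi0.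
case=> /(congr1 val) /= e1 /(congr1 val) /= e2 /(congr1 val) /= e3.
rewrite !inordK in e1; try by lia.
have enm : nm (s j) = nm (s i) by lia.
rewrite enm in e2 e3.
have mod_bound x : (absz (x %% nm (s i))%Z < M.+1)%N.
  by have := modz_ge0 x (introN eqP ni0); have := ltz_mod x (introN eqP ni0); lia.
rewrite !inordK // in e2 e3.
have mod_diff x y : absz (x %% nm (s i))%Z = absz (y %% nm (s i))%Z ->
    exists u, y = x + nm (s i) * u.
  move=> exy; exists ((y %/ nm (s i))%Z - (x %/ nm (s i))%Z).
  have emod : (x %% nm (s i))%Z = (y %% nm (s i))%Z.
    by rewrite -(gez0_abs (modz_ge0 x _)) ?exy ?gez0_abs ?modz_ge0 //; apply/eqP.
  by rewrite {1}(divz_eq y (nm (s i))) {1}(divz_eq x (nm (s i))) emod; ring.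
have [u xE] := mod_diff _ _ e2; have [w yE] := mod_diff _ _ e3.
move: (s i) (s j) vij yi0 yj0 ni0 enm xE yE {e1 e2 e3 mod_diff mod_bound Mi Mj}.
move=> [x1 y1] [x2 y2] /= vij y10 y20; set n := nm (x1, y1) => n0 enm xE yE.
have nE : x1 ^+ 2 - d%:Z * y1 ^+ 2 = n by [].
have nE2 : x2 ^+ 2 - d%:Z * y2 ^+ 2 = n by rewrite -enm.
(* [X + Y r] is the quotient of [x2 + y2 r] by [x1 + y1 r], that is [(x2 + y2 r) (x1 - y1 r) / n];
   the congruences modulo [n] make the division exact. *)
pose X := 1 + x1 * u - d%:Z * y1 * w; pose Y := x1 * w - y1 * u.
have XE : n * X = x1 * x2 - d%:Z * y1 * y2.
  have -> : n * X = n + n * (x1 * u - d%:Z * y1 * w) by rewrite /X; ring.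
  by rewrite -[Z in Z + _]nE xE yE; ring.
have YE : n * Y = x1 * y2 - x2 * y1 by rewrite xE yE /Y; ring.
exists X, Y; split; last first.
  have : n ^+ 2 * (X ^+ 2 - d%:Z * Y ^+ 2) = n ^+ 2 * 1.
    have -> : n ^+ 2 * (X ^+ 2 - d%:Z * Y ^+ 2) = (n * X) ^+ 2 - d%:Z * (n * Y) ^+ 2 by ring.
    by rewrite XE YE mulr1 [n ^+ 2]expr2 -{1}nE -nE2; ring.
  by apply: mulfI; rewrite expf_neq0 //; apply/eqP.
(* If [Y = 0], the two pairs are proportional of equal norm with positive second entries, hence
   equal, against the strict decrease of [v]. *)
move=> Y0; rewrite Y0 mulr0 in YE.
have : n * y1 ^+ 2 = n * y2 ^+ 2.
  rewrite -{1}nE2 -nE !mulrBl; congr (_ - _); last by ring.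
  by rewrite -!exprMn; congr (_ ^+ 2); lia.
move/(mulfI (introN eqP n0)) => ey.
have ey' : y1 = y2 by apply/eqP; rewrite -(@eqrXn2 _ 2) ?ltW //; apply/eqP.
have ex : x1 = x2.
  by apply: (mulIf (lt0r_neq0 y10)); apply/eqP; rewrite -subr_eq0 {1}ey' -YE.
by move: vij; rewrite /v ex ey' ltxx.
Qed.

(** The root of [a] is [g = gcdn a c]. With [a = g a'] and [c = g c'], the relation [a' b = g c'^2]
    and coprimality give [a' %| g] and [g %| a']. *)
Lemma coprime_mul_square (a b c : nat) : coprime a b -> (0 < a)%N ->
  (a * b = c * c)%N -> exists s t : nat, [/\ a = s * s, b = t * t & c = s * t]%N.
Proof.
move=> cab a0 eab; pose g := gcdn a c.
have g0 : (0 < g)%N by rewrite gcdn_gt0 a0.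
have [a' aE] : exists a', a = (g * a')%N.
  by have /dvdnP[k ->] := dvdn_gcdl a c; exists k; rewrite mulnC.
have [c' cE] : exists c', c = (g * c')%N.
  by have /dvdnP[k kE] := dvdn_gcdr a c; exists k; rewrite {1}kE mulnC.
have cac : coprime a' c'.
  by rewrite /coprime -(eqn_pmul2l g0) muln1 muln_gcdr -aE -cE.
have e1 : (a' * b = g * (c' * c'))%N.
  by apply/eqP; rewrite -(eqn_pmul2l g0); apply/eqP; rewrite mulnA -aE eab cE; lia.
have ga : (a' %| g)%N.
  by rewrite -(@Gauss_dvdl a' g (c' * c')) ?coprimeMr ?cac // -e1 dvdn_mulr.
have ag : (g %| a')%N.
  rewrite -(@Gauss_dvdl g a' b); first by rewrite e1 dvdn_mulr.
  by apply: coprime_dvdl cab; rewrite aE dvdn_mulr.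
have eg : a' = g by apply/eqP; rewrite eqn_dvd ga ag.
exists g, c'; split=> //; first by rewrite {1}aE eg.
by apply/eqP; rewrite -(eqn_pmul2l g0) -e1 eg.
Qed.

(** Cancelling [p] from the factor that it divides reduces this to [coprime_mul_square]. *)
Lemma coprime_mul_prime_square (p a b c : nat) : prime p -> coprime a b ->
    (0 < a)%N -> (0 < b)%N -> (a * b = p * (c * c))%N ->
  exists s t : nat, c = (s * t)%N /\
    (a = (p * (s * s))%N /\ b = (t * t)%N \/ a = (s * s)%N /\ b = (p * (t * t))%N).
Proof.
move=> pp cab a0 b0 eab; have p0 := prime_gt0 pp.
have : (p %| a * b)%N by rewrite eab dvdn_mulr.
rewrite Euclid_dvdM // => /orP[/dvdnP[k kE]|/dvdnP[k kE]].
  have k0 : (0 < k)%N by lia.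
  have ck : coprime k b by apply: coprime_dvdl cab; rewrite kE dvdn_mulr.
  have ek : (k * b = c * c)%N.
    by apply/eqP; rewrite -(eqn_pmul2l p0); apply/eqP; rewrite -eab kE; lia.
  have [s [t [kE' -> ->]]] := coprime_mul_square ck k0 ek.
  by exists s, t; split=> //; left; rewrite kE kE' mulnC.
have ck : coprime a k by apply: coprime_dvdr cab; rewrite kE dvdn_mulr.
have ek : (a * k = c * c)%N.
  by apply/eqP; rewrite -(eqn_pmul2l p0); apply/eqP; rewrite -eab kE; lia.
have [s [t [-> kE' ->]]] := coprime_mul_square ck a0 ek.
by exists s, t; split=> //; right; rewrite kE kE' mulnC.
Qed.

(** Minimality is imposed on [y] alone: [y] determines [x > 0], and the two grow together. *)
Definition pell_fundamental (d : nat) (x y : int) : Prop :=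
  [/\ 0 < x, 0 < y, x ^+ 2 - d%:Z * y ^+ 2 = 1 &
    forall X Y : int, X ^+ 2 - d%:Z * Y ^+ 2 = 1 -> 0 < Y -> y <= Y].

Lemma pell_fundamental_exists (R : realType) (d : nat) :
    (forall x y : int, x ^+ 2 = d%:Z * y ^+ 2 -> y = 0) ->
  exists x y : int, pell_fundamental d x y.
Proof.
move=> /(pell_solution R)[x [y [y0 xy]]].
pose P n := `[< (0 < n)%N /\ exists x : int, x ^+ 2 - d%:Z * n%:Z ^+ 2 = 1 >].
have exP : exists n, P n.
  exists (absz y); apply/asboolP; split; first by lia.
  by exists x; rewrite -xy -[in RHS](real_normK (num_real y)).
case: (ex_minnP exP) => n /asboolP[n0 [z zn]] nmin.
exists `|z|, n%:Z; split; first by nia.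
- by lia.
- by rewrite real_normK ?num_real.
move=> X Y XY Y0; have : (n <= absz Y)%N.
  apply/nmin/asboolP; split; first by lia.
  by exists X; rewrite -XY -[in RHS](real_normK (num_real Y)).
by lia.
Qed.

(* Factor [x ^ 2 - 1 = p y ^ 2] as [(x - 1) (x + 1)]; if [x] were odd, halving both
   factors would give a smaller solution or contradict [p = 3 mod 4]. *)
Lemma fundamental_twice_square (p : nat) (x y : int) :
    prime p -> p = 3 %[mod 4] -> pell_fundamental p x y ->
  exists s t : int, [/\ s ^+ 2 - p%:Z * t ^+ 2 = 2 \/ s ^+ 2 - p%:Z * t ^+ 2 = -2,
    s ^+ 2 + p%:Z * t ^+ 2 = 2 * x, s * t = y & exists z : int, x = 2 * z].
Proof.
move=> pp p4 [x0 y0 xy ymin]; have p0 := prime_gt0 pp.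
have [q qE] : exists q, p = (4 * q + 3)%N.
  by exists (p %/ 4)%N; rewrite {1}(divn_eq p 4) p4 mulnC.
case: x x0 xy => // x x0 xy; case: y y0 xy ymin => // y y0 xy ymin.
have x1 : (1 < x)%N by nia.
have exy : ((x - 1) * (x + 1) = p * (y * y))%N by nia.
have [z [zE|zE]] : exists z : nat, x = (2 * z)%N \/ x = (2 * z + 1)%N.
- by exists (x %/ 2)%N; lia.
- have cop : coprime (x - 1) (x + 1).
    have -> : (x + 1 = 2 + (x - 1))%N by lia.
    by rewrite /coprime gcdnDr -/(coprime _ _) coprimen2; lia.
  have x10 : (0 < x - 1)%N by lia.
  have x20 : (0 < x + 1)%N by lia.
  have [s [t [yE [[h1 h2]|[h1 h2]]]]] := coprime_mul_prime_square pp cop x10 x20 exy.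
  + exists t%:Z, s%:Z; split; [left; lia|lia|lia|by exists z%:Z; lia].
  + exists s%:Z, t%:Z; split; [right; lia|lia|lia|by exists z%:Z; lia].
have [w wE] : exists w : nat, y = (2 * w)%N.
  have [w [wE|wE]] : exists w : nat, y = (2 * w)%N \/ y = (2 * w + 1)%N.
  - by exists (y %/ 2)%N; lia.
  - by exists w.
  by exfalso; move: exy; rewrite zE wE qE; lia.
have ezw : (z * (z + 1) = p * (w * w))%N by move: exy; rewrite zE wE; lia.
have cz : coprime z (z + 1) by rewrite addn1 coprimenS.
have z10 : (0 < z)%N by lia.
have z20 : (0 < z + 1)%N by lia.
have [s [t [yE [[h1 h2]|[h1 h2]]]]] := coprime_mul_prime_square pp cz z10 z20 ezw.
- have s0 : (0 < s)%N by rewrite lt0n; apply/eqP => s0; move: h1; rewrite s0; lia.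
  have t0 : (0 < t)%N by rewrite lt0n; apply/eqP => t0; move: h2; rewrite t0; lia.
  (* Here [z = p s^2] and [z + 1 = t^2], so [(t, s)] solves the equation, while [s < 2 s t = y]. *)
  have ts : t%:Z ^+ 2 - p%:Z * s%:Z ^+ 2 = 1 by lia.
  by have := ymin _ _ ts; have := leq_pmulr s t0; lia.
(* The other splitting gives [s^2 + 1 = p t^2], impossible modulo 4. *)
exfalso.
have [t' tE] : exists t' : nat, t = (2 * t')%N \/ t = (2 * t' + 1)%N.
  by exists (t %/ 2)%N; lia.
have [s' sE] : exists s' : nat, s = (2 * s')%N \/ s = (2 * s' + 1)%N.
  by exists (s %/ 2)%N; lia.
by move: h2; rewrite h1 qE; case: tE => ->; case: sE => ->; lia.
Qed.

(** Descent: dividing by the fundamental solution lowers [Y] while keeping it nonnegative. For the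
    parity clause, [x] is even and [d], [y] are odd, so each multiplication by [x + y r] flips the
    parity of [X], starting from [X = 1] at [k = 0]. *)
Lemma pell_powers (R : realType) (d : nat) (x y : int) (r : R) :
    r ^+ 2 = d%:R -> 0 < r -> d = 3 %[mod 4] -> pell_fundamental d x y ->
    (exists z : int, x = 2 * z) ->
  forall X Y : int, X ^+ 2 - d%:Z * Y ^+ 2 = 1 ->
  exists k z : int, `|X%:~R + Y%:~R * r| = (x%:~R + y%:~R * r) ^ k /\
     X = k + 1 + 2 * z.
Proof.
move=> r2 r0 d4 [x0 y0 xy ymin] [x' x'E]; set e := x%:~R + y%:~R * r.
have [q qE] : exists q, d = (4 * q + 3)%N.
  by exists (d %/ 4)%N; rewrite {1}(divn_eq d 4) d4 mulnC.
have normE (X Y : int) : X ^+ 2 - d%:Z * Y ^+ 2 = 1 ->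
    (X%:~R + Y%:~R * r) * (X%:~R - Y%:~R * r) = 1.
  move=> h; have -> : (X%:~R + Y%:~R * r) * (X%:~R - Y%:~R * r)
    = X%:~R ^+ 2 - r ^+ 2 * Y%:~R ^+ 2 by ring.
  rewrite r2; have := congr1 (fun z : int => z%:~R : R) h.
  by rewrite intrB intrM !rmorphXn.
have e0 : 0 < e by rewrite addr_gt0 ?mulr_gt0 ?ltr0z.
pose P X Y := exists k z : int, `|X%:~R + Y%:~R * r| = e ^ k /\ X = k + 1 + 2 * z.
have PN X Y : P (- X) (- Y) -> P X Y.
  move=> [k [z [h1 h2]]]; exists k, (- z - k - 1); split; last by lia.
  by rewrite -h1 -normrN !rmorphN /=; congr `|_|; ring.
(* For norm 1 the conjugate is the inverse, so [k] becomes [- k], of the same parity. *)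
have PC X Y : X ^+ 2 - d%:Z * Y ^+ 2 = 1 -> P X (- Y) -> P X Y.
  move=> h [k [z [h1 h2]]]; exists (- k), (z + k); split; last by lia.
  rewrite -invr_expz -h1 rmorphN mulNr -normfV; congr `|_|.
  by apply: (mulIf (_ : X%:~R - Y%:~R * r != 0)); rewrite ?normE ?mulVf //;
    apply/eqP => h0; have := normE _ _ h; rewrite h0 mulr0 => /esym/eqP; rewrite oner_eq0.
have main (n : nat) : forall (m : nat) (X : int), (m <= n)%N -> 0 < X ->
    X ^+ 2 - d%:Z * m%:Z ^+ 2 = 1 -> P X m.
  elim: n => [|n IH] m X mn X0 h.
    have m0 : m = 0%N by lia.
    have X1 : X = 1 by rewrite m0 in h; nia.
    by exists 0, 0; rewrite m0 X1 /= mul0r addr0 normr1 expr0z.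
  have [m0|m0] := posnP m; first by apply: IH => //; lia.
  have ym : y <= m by apply: ymin h _; lia.
  (* [X' + Y' r = (X + m r) (x - y r)], the quotient of [X + m r] by [e]. *)
  pose X' : int := X * x - d%:Z * m%:Z * y; pose Y' : int := m%:Z * x - X * y.
  have mz0 : 0 < m%:Z by rewrite ltz_nat.
  have dz0 : 0 <= d%:Z by [].
  have x1 : 0 <= x - 1 by rewrite subr_ge0 -gtz0_ge1.
  have XE : X ^+ 2 = 1 + d%:Z * m%:Z ^+ 2 by rewrite -h; ring.
  have xE : x ^+ 2 = 1 + d%:Z * y ^+ 2 by rewrite -xy; ring.
  have sq_y : 0 < y ^+ 2 by rewrite exprn_gt0.
  have sq_m : 0 < m%:Z ^+ 2 by rewrite exprn_gt0.
  have [x0' y0' X0' mz0'] : [/\ 0 <= x, 0 <= y, 0 <= X & 0 <= m%:Z] by rewrite !ltW.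
  have nn (a b : int) : 0 <= a -> 0 <= b -> a * b \in Num.nneg.
    by move=> a0 b0; rewrite nnegrE mulr_ge0.
  have X'0 : 0 < X'.
    rewrite /X' subr_gt0 -(@ltr_pXn2r _ 2) ?nn ?mulr_ge0 //.
    rewrite !exprMn XE xE -subr_gt0.
    have -> : (1 + d%:Z * m%:Z ^+ 2) * (1 + d%:Z * y ^+ 2)
        - d%:Z ^+ 2 * m%:Z ^+ 2 * y ^+ 2 = 1 + d%:Z * m%:Z ^+ 2 + d%:Z * y ^+ 2 by ring.
    have dn (a : int) : 0 < a -> 0 <= d%:Z * a by move=> /ltW; apply: mulr_ge0.
    by have := dn _ sq_y; have := dn _ sq_m; lia.
  have Y'0 : 0 <= Y'.
    rewrite /Y' subr_ge0 -(@ler_pXn2r _ 2) ?nn //.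
    rewrite !exprMn XE xE -subr_ge0.
    have -> : m%:Z ^+ 2 * (1 + d%:Z * y ^+ 2) - (1 + d%:Z * m%:Z ^+ 2) * y ^+ 2
      = m%:Z ^+ 2 - y ^+ 2 by ring.
    by rewrite subr_ge0 ler_pXn2r.
  have Y'm : Y' < m%:Z.
    suff : m%:Z * (x - 1) < X * y by rewrite /Y'; lia.
    rewrite -(@ltr_pXn2r _ 2) ?nn // !exprMn XE.
    have -> : (1 + d%:Z * m%:Z ^+ 2) * y ^+ 2 = y ^+ 2 + m%:Z ^+ 2 * (x ^+ 2 - 1).
      by rewrite xE; ring.
    apply: (@le_lt_trans _ _ (m%:Z ^+ 2 * (x ^+ 2 - 1))); last by rewrite ltrDr.
    apply: ler_wpM2l (ltW sq_m) _ _ _; rewrite -subr_ge0.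
    have -> : x ^+ 2 - 1 - (x - 1) ^+ 2 = 2 * (x - 1) by ring.
    by rewrite mulr_ge0.
  have h' : X' ^+ 2 - d%:Z * Y' ^+ 2 = 1.
    rewrite /X' /Y'.
    have -> : (X * x - d%:Z * m%:Z * y) ^+ 2 - d%:Z * (m%:Z * x - X * y) ^+ 2
      = (X ^+ 2 - d%:Z * m%:Z ^+ 2) * (x ^+ 2 - d%:Z * y ^+ 2) by ring.
    by rewrite h xy.
  have Y'E : Y' = (absz Y')%:Z by lia.
  have [k [z [k1 k2]]] : P X' (absz Y').
    by apply: IH => //; [lia | rewrite -Y'E].
  (* Modulo 4, norm 1 and [x] even make [y] odd and give [X] and [m] opposite parities; hence [X']
     has the parity of [m], opposite to that of [X]. *)
  have [z' z'E] : exists z', X = k + 2 + 2 * z'.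
    have [u uE] : exists u, y = 2 * u + 1.
      exists ((y %/ 2)%Z).
      have [//|yE] : y = 2 * (y %/ 2)%Z + 1 \/ y = 2 * (y %/ 2)%Z by lia.
      by exfalso; move: xy; rewrite x'E yE; lia.
    have [a aE] : exists a, X = m%:Z + 1 + 2 * a.
      have : exists a, X = 2 * a \/ X = 2 * a + 1 by exists (X %/ 2)%Z; lia.
      have : exists b, m%:Z = 2 * b \/ m%:Z = 2 * b + 1 by exists (m %/ 2)%Z; lia.
      move=> [b bE] [a aE].
      case: aE => aE; case: bE => bE; move: h; rewrite aE bE qE PoszD PoszM => h.
      - by exfalso; lia.
      - by exists (a - b - 1); lia.
      - by exists (a - b); lia.
      - by exfalso; lia.
    move: k2; rewrite /X' x'E uE qE PoszD PoszM => k2.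
    exists (X * x' - (4 * q%:Z * m%:Z * u + 2 * q%:Z * m%:Z + 3 * m%:Z * u + m%:Z)
            - z + a - k - 1).
    by lia.
  exists (k + 1), z'; split; last by lia.
  rewrite expfzDr ?gt_eqF // expr1z -k1 -Y'E -[Z in _ = _ * Z]ger0_norm ?(ltW e0) // -normrM.
  congr `|_|; rewrite /X' /Y' /e !intrB !intrM.
  have eE : (x%:~R + y%:~R * r) * (x%:~R - y%:~R * r) = 1 by apply: normE.
  have -> : X%:~R * x%:~R - d%:Z%:~R * m%:~R * y%:~R + (m%:~R * x%:~R - X%:~R * y%:~R) * r
    = (X%:~R + m%:~R * r) * (x%:~R - y%:~R * r).
    rewrite -[d%:Z%:~R]/(d%:R : R) -r2; ring.
  by rewrite -mulrA [(x%:~R - _) * _]mulrC eE mulr1.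
move=> X Y; wlog X0 : X Y / 0 <= X.
  move=> W h; have [?|X0] := leP 0 X; first exact: W.
  by apply: PN; apply: W; rewrite ?sqrrN //; lia.
wlog Y0 : Y / 0 <= Y.
  move=> W h; have [?|Y0] := leP 0 Y; first exact: W.
  by apply: PC => //; apply: W; rewrite ?sqrrN //; lia.
move=> h; have -> : Y = (absz Y)%:Z by lia.
apply: (main (absz Y)) => //; first by nia.
by rewrite -h; congr (_ - _ * _ ^+ 2); lia.
Qed.

(** * Algebraic integers and relative norms *)

(** If [y] were nonzero, the exponent of [p] would be even in [x ^+ 2] and odd in [n * y ^+ 2]. Only
    one odd exponent is asked for, so that [n] can be a prime or [p1 * p2]. *)
Lemma odd_logn_nonsquare (p n : nat) : odd (logn p n) ->
  forall x y : int, x ^+ 2 = n%:Z * y ^+ 2 -> y = 0.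
Proof.
move=> on x y /(congr1 absz); rewrite abszM !abszX /= => exy.
have n0 : (0 < n)%N by case: n on {exy} => //; rewrite logn0.
have [y0|y0] := posnP (absz y); first by apply/eqP; rewrite -absz_eq0 y0.
have := congr1 (fun z => odd (logn p z)) exy.
by rewrite lognM ?expn_gt0 ?y0 // !lognX oddD !oddM /= on.
Qed.

Lemma odd_logn_nonsquare_rat (p n : nat) : odd (logn p n) ->
  forall a b : rat, a ^+ 2 = n%:R * b ^+ 2 -> b = 0.
Proof.
move=> on a b e; suff /eqP : numq b * denq a = 0.
  by rewrite mulf_eq0 denq_eq0 orbF numq_eq0 => /eqP.
apply: (odd_logn_nonsquare on (x := numq a * denq b)); apply: (@intr_inj rat).
rewrite !expr2 !intrM !numqE -[(Posz n)%:~R]/(n%:R : rat).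
have -> : n%:R * (b * (denq b)%:~R * (denq a)%:~R * (b * (denq b)%:~R * (denq a)%:~R))
  = (n%:R * b ^+ 2) * ((denq b)%:~R * (denq a)%:~R) ^+ 2 by ring.
by rewrite -e; ring.
Qed.

Definition int_rat (q : rat) : Prop := exists m : int, q = m%:~R.

(** The monic integer polynomial killing [q] is transported from [R] through [rat] to [algC], where
    rational algebraic integers are integers. *)
Lemma int_rat_of_integral (R : realType) (q : rat) :
  integralOver (intr : int -> R) (ratr q) -> int_rat q.
Proof.
case=> p pm pq.
have : (ratr q : algC) \is a Num.int.
  apply: Cint_rat_Aint; first exact: Crat_rat.
  apply: (@root_monic_Aint (map_poly intr p)).
  - move: pq; rewrite /root.
    have -> : map_poly intr p = map_poly ratr (map_poly intr p : {poly rat}) :> {poly R}.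
      by rewrite -map_poly_comp; apply: eq_map_poly => z /=; rewrite ratr_int.
    have -> : map_poly intr p = map_poly ratr (map_poly intr p : {poly rat}) :> {poly algC}.
      by rewrite -map_poly_comp; apply: eq_map_poly => z /=; rewrite ratr_int.
    by rewrite !horner_map !fmorph_eq0.
  - exact: monic_map.
  - by apply/polyOverP => i; rewrite coef_map /= intr_int.
by move/intrP => [m mE]; exists m; apply: (@fmorph_inj _ _ (@ratr algC)); rewrite [LHS]mE [RHS]ratr_int.
Qed.

Definition squarefree (n : nat) : Prop := forall d, (d * d %| n)%N -> d = 1%N.

(** The squared denominator of [q] is coprime to the squared numerator, so it divides [n]. *)
Lemma squarefree_int_rat (n : nat) (q : rat) :
  squarefree n -> int_rat (n%:R * q ^+ 2) -> int_rat q.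
Proof.
move=> sf [m mE].
have e : n%:Z * numq q ^+ 2 = m * denq q ^+ 2.
  apply: (@intr_inj rat); rewrite !expr2 !intrM !numqE -mE -[(Posz n)%:~R]/(n%:R : rat).
  by ring.
have dvd : (absz (denq q) * absz (denq q) %| n)%N.
  rewrite mulnn -(@Gauss_dvdl _ _ (absz (numq q) ^ 2)%N).
    have := congr1 absz e; rewrite !expr2 !abszM -mulnn /= => ->.
    by rewrite mulnn dvdn_mull.
  by rewrite coprimeXl // coprimeXr // coprime_sym coprime_num_den.
have d1 : denq q = 1 by have := sf _ dvd; rewrite -{2}[denq q]gez0_abs // => ->.
by exists (numq q); rewrite -[LHS]divq_num_den d1 divr1.
Qed.

Lemma squarefree_prime (p : nat) : prime p -> squarefree p.
Proof.
move=> pp d dp; have /primeP[_ /(_ d (dvdn_trans (dvdn_mulr d (dvdnn d)) dp))] := pp.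
case/orP => /eqP // dE; move: dp; rewrite dE => /dvdn_leq.
by have := prime_gt1 pp; nia.
Qed.

Lemma squarefree_mul_primes (p q : nat) : prime p -> prime q -> p <> q ->
  squarefree (p * q).
Proof.
move=> pp pq npq d dpq; have [//|d1] := altP (d =P 1%N).
have d0 : (1 < d)%N.
  case: d d1 dpq => [|[|]] // _; rewrite mul0n dvd0n muln_eq0.
  by have := prime_gt0 pp; have := prime_gt0 pq; lia.
set l := pdiv d; have pl : prime l by apply: pdiv_prime.
have ll : (l * l %| p * q)%N by apply: dvdn_trans dpq; rewrite dvdn_mul ?pdiv_dvd.
have : (l %| p * q)%N by apply: dvdn_trans ll; rewrite dvdn_mulr.
have ne : (p %| q)%N = false.
  by rewrite (dvdn_prime2 pp pq); apply/negP => /eqP.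
have ne' : (q %| p)%N = false.
  by rewrite (dvdn_prime2 pq pp); apply/negP => /eqP h; apply: npq.
rewrite Euclid_dvdM // !dvdn_prime2 // => /orP[/eqP lE|/eqP lE]; move: ll; rewrite lE.
  by rewrite dvdn_pmul2l ?prime_gt0 // ne.
by rewrite dvdn_pmul2r ?prime_gt0 // ne'.
Qed.

Section Norms.
Variable R : realType.
Notation integral := (integralOver (intr : int -> R)).

(** Trace and norm are integers, which makes [m = 2 a] and [n = 2 b] integers with [m^2 - p n^2]
    divisible by 4. As [p = 3 mod 4], this reads [m^2 + n^2 = 0 mod 4], so both are even. *)
Lemma quadratic_integers (p : nat) (r : R) (a b : rat) :
    prime p -> p = 3 %[mod 4] -> r ^+ 2 = p%:R ->
    integral (ratr a + ratr b * r) -> integral (ratr a - ratr b * r) ->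
  int_rat a /\ int_rat b.
Proof.
move=> pp p4 r2 i1 i2.
have [q qE] : exists q, p = (4 * q + 3)%N.
  by exists (p %/ 4)%N; rewrite {1}(divn_eq p 4) p4 mulnC.
have [m mE] : int_rat (2 * a).
  apply: (@int_rat_of_integral R); rewrite rmorphM /= ratr_nat.
  have -> : 2 * ratr a = (ratr a + ratr b * r) + (ratr a - ratr b * r) by ring.
  exact: integral_add.
have [N NE] : int_rat (a ^+ 2 - p%:R * b ^+ 2).
  apply: (@int_rat_of_integral R); rewrite !expr2 rmorphB !rmorphM /= ratr_nat -r2.
  have -> : ratr a * ratr a - r ^+ 2 * (ratr b * ratr b)
    = (ratr a + ratr b * r) * (ratr a - ratr b * r) by ring.
  exact: integral_mul.
have [n nE] : int_rat (2 * b).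
  apply: (squarefree_int_rat (squarefree_prime pp)); exists (m ^+ 2 - 4 * N).
  by rewrite !expr2 intrB !intrM /= -mE -NE; ring.
have : m ^+ 2 - p%:Z * n ^+ 2 = 4 * N.
  apply: (@intr_inj rat); rewrite !expr2 !(intrB, intrM) /= -mE -nE -NE.
  by rewrite -[(Posz p)%:~R]/(p%:R : rat); ring.
have h2 (c : rat) (u v : int) : 2 * c = u%:~R -> u = 2 * v -> int_rat c.
  move=> cu uv; exists v; apply: (@mulfI _ 2) => //.
  by rewrite cu uv intrM.
have : exists u, m = 2 * u \/ m = 2 * u + 1 by exists (m %/ 2)%Z; lia.
have : exists v, n = 2 * v \/ n = 2 * v + 1 by exists (n %/ 2)%Z; lia.
move=> [v vE] [u uE] e.
case: uE => uE; case: vE => vE; last 3 first.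
- by exfalso; move: e; rewrite uE vE qE PoszD PoszM; lia.
- by exfalso; move: e; rewrite uE vE qE PoszD PoszM; lia.
- by exfalso; move: e; rewrite uE vE qE PoszD PoszM; lia.
by split; [apply: h2 mE uE | apply: h2 nE vE].
Qed.

(* The integrality conditions force [B] and [C] to have the same parity. *)
Lemma int_rat_four (A B C D X Y : int) (p1 p2 : nat) :
    p1 = 3 %[mod 4] -> p2 = 3 %[mod 4] ->
    A ^+ 2 + p1%:Z * B ^+ 2 - p2%:Z * C ^+ 2 - p1%:Z * p2%:Z * D ^+ 2 = 4 * X ->
    A * B - p2%:Z * C * D = 2 * Y ->
  exists z : int, p1%:Z * B ^+ 2 - p2%:Z * C ^+ 2 = 4 * z.
Proof.
move=> p14 p24.
have [q1 ->] : exists q, p1 = (4 * q + 3)%N.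
  by exists (p1 %/ 4)%N; rewrite {1}(divn_eq p1 4) p14 mulnC.
have [q2 ->] : exists q, p2 = (4 * q + 3)%N.
  by exists (p2 %/ 4)%N; rewrite {1}(divn_eq p2 4) p24 mulnC.
have half (n : int) : exists u, n = 2 * u \/ n = 2 * u + 1 by exists (n %/ 2)%Z; lia.
have [a aE] := half A; have [b bE] := half B.
have [c cE] := half C; have [d dE] := half D.
rewrite !(PoszM, PoszD) => h1 h2.
case: bE => bE; case: cE => cE; rewrite bE cE in h1 h2 *.
- by exists ((4 * q1%:Z + 3) * b ^+ 2 - (4 * q2%:Z + 3) * c ^+ 2); ring.
- by exfalso; case: aE => aE; case: dE => dE; rewrite aE dE in h1 h2; lia.
- by exfalso; case: aE => aE; case: dE => dE; rewrite aE dE in h1 h2; lia.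
- exists ((4 * q1%:Z + 3) * (b ^+ 2 + b) - (4 * q2%:Z + 3) * (c ^+ 2 + c) + q1%:Z - q2%:Z).
  by ring.
Qed.

(* Image of [a + b s1 + c s2 + d s1 s2] under the embedding with [s1 |-> e1] and
   [s2 |-> e2]. *)
Definition biquad (a b c d : rat) (e1 e2 : R) : R :=
  ratr a + ratr b * e1 + ratr c * e2 + ratr d * (e1 * e2).

(** The four products are the relative norms to the two quadratic subfields and their conjugates.
    Their rational parts differ by [2 (p1 b^2 - p2 c^2)], and [int_rat_four], applied to the doubled
    coefficients, shows that the bracket is an integer. *)
Lemma biquad_relative_norms (p1 p2 : nat) (r1 r2 : R) (a b c d : rat) :
    prime p1 -> prime p2 -> p1 <> p2 -> p1 = 3 %[mod 4] -> p2 = 3 %[mod 4] ->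
    r1 ^+ 2 = p1%:R -> r2 ^+ 2 = p2%:R ->
    let v := biquad a b c d in
    integral (v r1 r2) -> integral (v r1 (- r2)) ->
    integral (v (- r1) r2) -> integral (v (- r1) (- r2)) ->
  exists X1 Y1 X2 Y2 z : int,
    [/\ v r1 r2 * v r1 (- r2) = X1%:~R + Y1%:~R * r1,
        v (- r1) r2 * v (- r1) (- r2) = X1%:~R - Y1%:~R * r1,
        v r1 r2 * v (- r1) r2 = X2%:~R + Y2%:~R * r2,
        v r1 (- r2) * v (- r1) (- r2) = X2%:~R - Y2%:~R * r2 &
        X1 = X2 + 2 * z].
Proof.
move=> pp1 pp2 np p14 p24 r12 r22 v i1 i2 i3 i4.
have r1E (x : R) : x * p1%:R = x * r1 ^+ 2 by rewrite r12.
have r2E (x : R) : x * p2%:R = x * r2 ^+ 2 by rewrite r22.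
(* The relative traces are integers of the quadratic subfields. *)
have [[A AE] [B BE]] : int_rat (2 * a) /\ int_rat (2 * b).
  apply: (quadratic_integers pp1 p14 r12); rewrite !rmorphM /= ratr_nat.
    have -> : 2 * ratr a + 2 * ratr b * r1 = v r1 r2 + v r1 (- r2) by rewrite /v /biquad; ring.
    exact: integral_add.
  have -> : 2 * ratr a - 2 * ratr b * r1 = v (- r1) r2 + v (- r1) (- r2).
    by rewrite /v /biquad; ring.
  exact: integral_add.
have [_ [C CE]] : int_rat (2 * a) /\ int_rat (2 * c).
  apply: (quadratic_integers pp2 p24 r22); rewrite !rmorphM /= ratr_nat.
    have -> : 2 * ratr a + 2 * ratr c * r2 = v r1 r2 + v (- r1) r2 by rewrite /v /biquad; ring.
    exact: integral_add.
  have -> : 2 * ratr a - 2 * ratr c * r2 = v r1 (- r2) + v (- r1) (- r2).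
    by rewrite /v /biquad; ring.
  exact: integral_add.
(* [v r1 r2 + v (- r1) (- r2) - 2 a = 2 d r1 r2], whose square is [p1 p2 (2 d)^2]. *)
have [D DE] : int_rat (2 * d).
  apply: (squarefree_int_rat (squarefree_mul_primes pp1 pp2 np)).
  apply: (@int_rat_of_integral R).
  rewrite natrM !expr2 !rmorphM /= !ratr_nat -r12 -r22.
  have -> : r1 ^+ 2 * r2 ^+ 2 * (2 * ratr d * (2 * ratr d)) =
     (v r1 r2 + v (- r1) (- r2) - ratr (2 * a)) * (v r1 r2 + v (- r1) (- r2) - ratr (2 * a)).
    by rewrite /v /biquad rmorphM /= ratr_nat; ring.
  have ia : integral (ratr (2 * a)).
    by rewrite AE ratr_int; apply: integral_id.
  by apply: integral_mul; apply: integral_sub ia; apply: integral_add.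
(* [x1 + y1 r1 = (a + b r1)^2 - p2 (c + d r1)^2], and symmetrically for [x2] and [y2]. *)
pose x1 := a ^+ 2 + p1%:R * b ^+ 2 - p2%:R * c ^+ 2 - p1%:R * p2%:R * d ^+ 2.
pose y1 := 2 * a * b - 2 * p2%:R * c * d.
pose x2 := a ^+ 2 + p2%:R * c ^+ 2 - p1%:R * b ^+ 2 - p1%:R * p2%:R * d ^+ 2.
pose y2 := 2 * a * c - 2 * p1%:R * b * d.
have e1 : v r1 r2 * v r1 (- r2) = ratr x1 + ratr y1 * r1.
  by rewrite /v /biquad /x1 /y1 !expr2 !(rmorph_nat, rmorphM, rmorphN, rmorphD) /= -r12 -r22; ring.
have e2 : v (- r1) r2 * v (- r1) (- r2) = ratr x1 - ratr y1 * r1.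
  by rewrite /v /biquad /x1 /y1 !expr2 !(rmorph_nat, rmorphM, rmorphN, rmorphD) /= -r12 -r22; ring.
have e3 : v r1 r2 * v (- r1) r2 = ratr x2 + ratr y2 * r2.
  by rewrite /v /biquad /x2 /y2 !expr2 !(rmorph_nat, rmorphM, rmorphN, rmorphD) /= -r12 -r22; ring.
have e4 : v r1 (- r2) * v (- r1) (- r2) = ratr x2 - ratr y2 * r2.
  by rewrite /v /biquad /x2 /y2 !expr2 !(rmorph_nat, rmorphM, rmorphN, rmorphD) /= -r12 -r22; ring.
have [[X1 X1E] [Y1 Y1E]] : int_rat x1 /\ int_rat y1.
  by apply: (quadratic_integers pp1 p14 r12); rewrite -?e1 -?e2; apply: integral_mul.
have [[X2 X2E] [Y2 Y2E]] : int_rat x2 /\ int_rat y2.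
  by apply: (quadratic_integers pp2 p24 r22); rewrite -?e3 -?e4; apply: integral_mul.
have [z zE] : exists z : int, p1%:Z * B ^+ 2 - p2%:Z * C ^+ 2 = 4 * z.
  apply: (@int_rat_four A B C D X1 Y1) => //; apply: (@intr_inj rat);
    rewrite ?expr2 !(intrB, intrD, intrM) /= -AE -BE -CE -DE -?X1E -?Y1E /x1 /y1
      -![(Posz _)%:~R]/(_%:R); ring.
exists X1, Y1, X2, Y2, z; split.
- by rewrite e1 X1E Y1E !ratr_int.
- by rewrite e2 X1E Y1E !ratr_int.
- by rewrite e3 X2E Y2E !ratr_int.
- by rewrite e4 X2E Y2E !ratr_int.
apply: (@intr_inj rat); apply: (@mulfI _ 2) => //.
have := congr1 (fun x : int => x%:~R : rat) zE.
rewrite !expr2 !(intrB, intrD, intrM) /= -BE -CE -X1E -X2E /x1 /x2.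
rewrite -![(Posz _)%:~R]/(_%:R) => h.
have -> : z%:~R = p1%:R * (b * b) - p2%:R * (c * c) :> rat.
  by apply: (@mulfI _ (4%:~R)) => //; rewrite -h; ring.
by ring.
Qed.

End Norms.

(** * The biquadratic field *)

Section Biquadratic.
Variables (K : fieldExtType rat) (p1 p2 : nat) (s1 s2 : K).
Hypotheses (s1E : s1 ^+ 2 = p1%:R) (s2E : s2 ^+ 2 = p2%:R).

Lemma in_alg_scale (a : rat) (x : K) : in_alg K a * x = a *: x.
Proof. exact: mulr_algl. Qed.

Lemma in_alg_eq0 (a : rat) : in_alg K a = 0 -> a = 0.
Proof. by move/eqP; rewrite fmorph_eq0 => /eqP. Qed.

(** The span of [1, s1, s2, s1 s2] contains 1 and is stable under multiplication by the generators,
    so it contains the algebra they generate. *)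
Lemma biquadratic_span (u : K) : <<1 & [:: s1; s2]>>%VS = {:K}%VS ->
  exists a b c d : rat, u = in_alg K a + in_alg K b * s1 + in_alg K c * s2 + in_alg K d * (s1 * s2).
Proof.
move=> gen; pose X := [tuple 1; s1; s2; s1 * s2] : 4.-tuple K.
have spanX w : w \in <<X>>%VS ->
    exists a b c d : rat, w = in_alg K a + in_alg K b * s1 + in_alg K c * s2 + in_alg K d * (s1 * s2).
  move=> /coord_span; rewrite !big_ord_recl big_ord0 /= => ->.
  do 4 eexists; rewrite !in_alg_scale addr0 !addrA; reflexivity.
have memX a b c d : in_alg K a + in_alg K b * s1 + in_alg K c * s2 + in_alg K d * (s1 * s2) \in <<X>>%VS.
  by rewrite !in_alg_scale !memvD // memvZ // memv_span // !inE eqxx ?orbT.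
have : (<<1 & [:: s1; s2]>> <= <<X>>)%VS.
  apply: agenv_sub_modl.
    by rewrite -memvE memv_span // inE eqxx.
  apply/prodvP => x y xU /spanX[a [b [c [d ->]]]].
  have [k [l [m ->]]] : exists k l m : rat, x = in_alg K k + in_alg K l * s1 + in_alg K m * s2.
    move/memv_addP: xU => [x1 /vlineP[k ->] [x2 x2U ->]].
    rewrite (@coord_span _ _ _ [tuple s1; s2] _ x2U) !big_ord_recl big_ord0 /=.
    do 3 eexists; rewrite !in_alg_scale addr0 !addrA; reflexivity.
  have -> : (in_alg K k + in_alg K l * s1 + in_alg K m * s2) *
      (in_alg K a + in_alg K b * s1 + in_alg K c * s2 + in_alg K d * (s1 * s2)) =
      in_alg K (k * a + l * b * p1%:R + m * c * p2%:R) +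
      in_alg K (k * b + l * a + m * d * p2%:R) * s1 +
      in_alg K (k * c + m * a + l * d * p1%:R) * s2 +
      in_alg K (k * d + l * c + m * b) * (s1 * s2); last exact: memX.
  by rewrite !(rmorph_nat, rmorphM, rmorphD) -s1E -s2E; ring.
by rewrite gen => /subvP/(_ u (memvf u))/spanX.
Qed.

Hypotheses (p1_prime : prime p1) (p2_prime : prime p2) (p1_neq_p2 : p1 <> p2).

Lemma quadratic_free (P Q : rat) : in_alg K P + in_alg K Q * s1 = 0 -> P = 0 /\ Q = 0.
Proof.
move=> h; have o1 : odd (logn p1 p1) by rewrite logn_prime // eqxx.
have Q0 : Q = 0.
  apply: (odd_logn_nonsquare_rat o1 (a := P)); apply/eqP; rewrite -subr_eq0; apply/eqP.
  apply: in_alg_eq0; rewrite !expr2 !(rmorph_nat, rmorphM, rmorphB) -s1E.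
  have -> : in_alg K P * in_alg K P - s1 ^+ 2 * (in_alg K Q * in_alg K Q) = (in_alg K P + in_alg K Q * s1) * (in_alg K P - in_alg K Q * s1) by ring.
  by rewrite h mul0r.
by split=> //; apply: in_alg_eq0; rewrite -h Q0 rmorph0 mul0r addr0.
Qed.

(** Multiplying by the conjugate under [s2 |-> - s2] gives a relation in [Q(s1)], hence two rational
    equations. Eliminating the mixed products leaves [a^2 = p2 c^2] or [a^2 = p1 p2 d^2], and odd
    valuations finish. *)
Lemma biquadratic_free (a b c d : rat) :
  in_alg K a + in_alg K b * s1 + in_alg K c * s2 + in_alg K d * (s1 * s2) = 0 ->
  [/\ a = 0, b = 0, c = 0 & d = 0].
Proof.
move=> h.
have o2 : odd (logn p2 p2) by rewrite logn_prime // eqxx.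
have o12 : odd (logn p1 (p1 * p2)).
  rewrite lognM ?prime_gt0 // !logn_prime // eqxx.
  by rewrite [p1 == p2](introF eqP p1_neq_p2).
have [h1 h2] : a ^+ 2 + p1%:R * b ^+ 2 - p2%:R * (c ^+ 2 + p1%:R * d ^+ 2) = 0
   /\ 2 * (a * b - p2%:R * (c * d)) = 0.
  apply: quadratic_free.
  rewrite !expr2 !(rmorph_nat, rmorphM, rmorphN, rmorphD) -s1E -s2E.
  rewrite -[RHS](mul0r (in_alg K a + in_alg K b * s1 - (in_alg K c * s2 + in_alg K d * (s1 * s2)))) -h.
  by ring.
have p10 : (p1%:R : rat) != 0 by rewrite pnatr_eq0 -lt0n prime_gt0.
have p20 : (p2%:R : rat) != 0 by rewrite pnatr_eq0 -lt0n prime_gt0.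
have {}h2 : a * b = p2%:R * (c * d).
  by apply/eqP; rewrite -subr_eq0; move/eqP: h2; rewrite mulf_eq0.
have {}h1 : a ^+ 2 + p1%:R * b ^+ 2 = p2%:R * (c ^+ 2 + p1%:R * d ^+ 2).
  by apply/eqP; rewrite -subr_eq0 h1.
have : (a ^+ 2 - p1%:R * b ^+ 2) ^+ 2 = (p2%:R * (c ^+ 2 - p1%:R * d ^+ 2)) ^+ 2.
  have -> : (a ^+ 2 - p1%:R * b ^+ 2) ^+ 2
    = (a ^+ 2 + p1%:R * b ^+ 2) ^+ 2 - 4 * p1%:R * (a * b) ^+ 2 by ring.
  by rewrite h1 h2; ring.
have sq0 (x y : rat) : x ^+ 2 = y * 0 ^+ 2 -> x = 0.
  by rewrite expr0n mulr0 => /eqP; rewrite sqrf_eq0 => /eqP.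
have half (x y : rat) : 2 * x = 2 * y -> x = y by apply: mulfI.
move/eqP; rewrite eqf_sqr => /orP[] /eqP h3.
  have e1 : a ^+ 2 = p2%:R * c ^+ 2 by apply: half; lra.
  have c0 := odd_logn_nonsquare_rat o2 e1.
  have a0 : a = 0 by move: e1; rewrite c0 => /sq0.
  have e2 : b ^+ 2 = p2%:R * d ^+ 2.
    by apply: (mulfI p10); move: h1; rewrite a0 c0 expr0n /= !add0r => ->; ring.
  have d0 := odd_logn_nonsquare_rat o2 e2.
  by split=> //; move: e2; rewrite d0 => /sq0.
have e1 : a ^+ 2 = (p1 * p2)%:R * d ^+ 2 by rewrite natrM; apply: half; lra.
have d0 := odd_logn_nonsquare_rat o12 e1.
have a0 : a = 0 by move: e1; rewrite d0 => /sq0.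
have e2 : (p1%:R * b) ^+ 2 = (p1 * p2)%:R * c ^+ 2.
  rewrite natrM exprMn expr2 -!mulrA; congr (_ * _).
  by move: h1; rewrite a0 d0 expr0n /= mulr0 add0r addr0.
have c0 := odd_logn_nonsquare_rat o12 e2.
split=> //; move: e2; rewrite c0 => /sq0 /eqP; rewrite mulf_eq0 (negPf p10).
by move/eqP.
Qed.

Lemma biquadratic_dim : (4 <= \dim {:K})%N.
Proof.
pose X := [tuple 1; s1; s2; s1 * s2] : 4.-tuple K.
have : free X.
  apply/freeP => k; rewrite !big_ord_recl big_ord0 /= addr0 !addrA -!in_alg_scale.
  rewrite mulr1 => /biquadratic_free[k0 k1 k2 k3].
  case=> [[|[|[|[|i]]]] lti] //; [rewrite -[RHS]k0|rewrite -[RHS]k1|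
    rewrite -[RHS]k2|rewrite -[RHS]k3]; congr (k _); exact: val_inj.
by rewrite /free => /eqP /= <-; rewrite dimvS ?subvf.
Qed.

End Biquadratic.

(** * Logarithms of units *)

Lemma ln_exprz (R : realType) (e : R) (k : int) : 0 < e -> ln (e ^ k) = k%:~R * ln e.
Proof.
move=> e0; case: k => n.
  by rewrite -exprnP lnXn // -mulr_natl.
by rewrite NegzE -invr_expz -exprnP lnV ?posrE ?exprn_gt0 // lnXn // rmorphN mulNr -mulr_natl.
Qed.

Lemma ln_normM (R : realType) (x y : R) : x != 0 -> y != 0 ->
  ln `|x * y| = ln `|x| + ln `|y|.
Proof. by move=> x0 y0; rewrite normrM lnM ?posrE ?normr_gt0. Qed.

(** Modulo 4 the norm is [X^2 + Y^2], which is never 3. *)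
Lemma norm_neqN1 (p : nat) (X Y : int) : p = 3 %[mod 4] -> X ^+ 2 - p%:Z * Y ^+ 2 <> -1.
Proof.
move=> p4.
have [q ->] : exists q, p = (4 * q + 3)%N.
  by exists (p %/ 4)%N; rewrite {1}(divn_eq p 4) p4 mulnC.
rewrite !(PoszM, PoszD).
have : exists u, X = 2 * u \/ X = 2 * u + 1 by exists (X %/ 2)%Z; lia.
have : exists v, Y = 2 * v \/ Y = 2 * v + 1 by exists (Y %/ 2)%Z; lia.
by move=> [v [->|->]] [u [->|->]]; lia.
Qed.

Lemma mulz_eq1 (m n : int) : m * n = 1 -> m = 1 \/ m = -1.
Proof.
move=> mn; have := congr1 absz mn; rewrite abszM /= => /eqP.
by rewrite muln_eq1 => /andP[/eqP h _]; lia.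
Qed.

Section UnitLogs.
Variable R : realType.
Notation integral := (integralOver (intr : int -> R)).

Lemma pell_norm_logs (p : nat) (r : R) (x y X Y : int) :
    r ^+ 2 = p%:R -> 0 < r -> p = 3 %[mod 4] -> pell_fundamental p x y ->
    (exists z : int, x = 2 * z) -> X ^+ 2 - p%:Z * Y ^+ 2 = 1 ->
  exists k z : int, [/\ ln `|X%:~R + Y%:~R * r| = k%:~R * ln (x%:~R + y%:~R * r),
    ln `|X%:~R - Y%:~R * r| = - (k%:~R * ln (x%:~R + y%:~R * r)) & X = k + 1 + 2 * z].
Proof.
move=> r2 r0 p4 fund even XY.
have [k [z [kE zE]]] := pell_powers r2 r0 p4 fund even XY.
have [x0 y0 _ _] := fund.
have e0 : 0 < x%:~R + y%:~R * r by rewrite addr_gt0 ?mulr_gt0 ?ltr0z.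
have nE : (X%:~R + Y%:~R * r) * (X%:~R - Y%:~R * r) = 1.
  have := congr1 (fun z : int => z%:~R : R) XY.
  rewrite !expr2 !(intrB, intrM) -[(Posz p)%:~R]/(p%:R : R) -r2 => h.
  by apply: etrans h; ring.
have nz1 : X%:~R + Y%:~R * r != 0 by apply/eqP => h; move/eqP: nE; rewrite h mul0r eq_sym oner_eq0.
have nz2 : X%:~R - Y%:~R * r != 0 by apply/eqP => h; move/eqP: nE; rewrite h mulr0 eq_sym oner_eq0.
exists k, z; split=> //; first by rewrite kE ln_exprz.
have := ln_normM nz1 nz2; rewrite nE normr1 ln1 kE ln_exprz // => h.
by apply/eqP; rewrite -subr_eq0 opprK addrC -h.
Qed.

(** With [alpha = s + t r], the relations [alpha^2 = 2 (x + y r)] and [|N(alpha)| = 2] are two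
    linear equations in the logarithms of [alpha] and its conjugate. *)
Lemma twice_square_logs (p : nat) (r : R) (x y s t : int) :
    r ^+ 2 = p%:R -> 0 < r -> 0 < x -> 0 < y ->
    s ^+ 2 - p%:Z * t ^+ 2 = 2 \/ s ^+ 2 - p%:Z * t ^+ 2 = -2 ->
    s ^+ 2 + p%:Z * t ^+ 2 = 2 * x -> s * t = y ->
  [/\ ln `|s%:~R + t%:~R * r| = (ln 2 + ln (x%:~R + y%:~R * r)) / 2,
      ln `|s%:~R - t%:~R * r| = (ln 2 - ln (x%:~R + y%:~R * r)) / 2,
      s%:~R + t%:~R * r != 0 & s%:~R - t%:~R * r != 0].
Proof.
move=> r2 r0 x0 y0 st stx sty.
have e0 : 0 < x%:~R + y%:~R * r by rewrite addr_gt0 ?mulr_gt0 ?ltr0z.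
have nE : `|(s%:~R + t%:~R * r) * (s%:~R - t%:~R * r)| = 2.
  have -> : (s%:~R + t%:~R * r) * (s%:~R - t%:~R * r) = (s ^+ 2 - p%:Z * t ^+ 2)%:~R.
    by rewrite !expr2 !(intrB, intrM) -[(Posz p)%:~R]/(p%:R : R) -r2; ring.
  by case: st => ->; rewrite ?rmorphN ?normrN ger0_norm.
have sE : (s%:~R + t%:~R * r) ^+ 2 = 2 * (x%:~R + y%:~R * r).
  have -> : 2 * (x%:~R + y%:~R * r) = (2 * x)%:~R + 2 * y%:~R * r.
    by rewrite intrM; ring.
  by rewrite -stx -sty !expr2 !(intrD, intrM) -[(Posz p)%:~R]/(p%:R : R) -r2; ring.
have nz1 : s%:~R + t%:~R * r != 0.
  by apply/eqP => h; move/eqP: nE; rewrite h mul0r normr0 eq_sym pnatr_eq0.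
have nz2 : s%:~R - t%:~R * r != 0.
  by apply/eqP => h; move/eqP: nE; rewrite h mulr0 normr0 eq_sym pnatr_eq0.
have l1 := congr1 (fun z : R => ln `|z|) sE.
rewrite expr2 !ln_normM // ?gt_eqF // in l1.
rewrite (gtr0_norm e0) [`|2|]gtr0_norm // in l1.
have := ln_normM nz1 nz2; rewrite nE => l2.
move: (ln _) (ln _) (ln _) (ln _) l1 l2 => A B C D l1 l2.
split=> //; lra.
Qed.

(** The relative norms of a unit solve Pell's equations, so they are powers of the fundamental
    solutions up to sign. The exponents share a parity because [X1] and [X2] do and each [Xi] has
    the parity of [ki + 1]. The inverse [w] certifies that [v] is a unit. *)
Lemma unit_logs (p1 p2 : nat) (r1 r2 : R) (x1 y1 x2 y2 : int)
    (a b c d a' b' c' d' : rat) :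
    prime p1 -> prime p2 -> p1 <> p2 -> p1 = 3 %[mod 4] -> p2 = 3 %[mod 4] ->
    r1 ^+ 2 = p1%:R -> r2 ^+ 2 = p2%:R -> 0 < r1 -> 0 < r2 ->
    pell_fundamental p1 x1 y1 -> (exists z : int, x1 = 2 * z) ->
    pell_fundamental p2 x2 y2 -> (exists z : int, x2 = 2 * z) ->
    let v e1 e2 := biquad a b c d (if e1 then r1 else - r1) (if e2 then r2 else - r2) in
    let w e1 e2 := biquad a' b' c' d' (if e1 then r1 else - r1) (if e2 then r2 else - r2) in
    (forall e1 e2, [/\ integral (v e1 e2), integral (w e1 e2) & v e1 e2 * w e1 e2 = 1]) ->
  let l1 := ln (x1%:~R + y1%:~R * r1) in
  let l2 := ln (x2%:~R + y2%:~R * r2) in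
  let L e1 e2 := ln `|v e1 e2| in
  exists k1 k2 z : int,
    [/\ L true true + L true false = k1%:~R * l1,
        L false true + L false false = - (k1%:~R * l1),
        L true true + L false true = k2%:~R * l2,
        L true false + L false false = - (k2%:~R * l2) & k1 = k2 + 2 * z].
Proof.
move=> pp1 pp2 np p14 p24 r12 r22 r10 r20 f1 ev1 f2 ev2 v w vw l1 l2 L.
have [X1 [Y1 [X2 [Y2 [z [h1 h2 h3 h4 zE]]]]]] : exists X1 Y1 X2 Y2 z : int,
    [/\ v true true * v true false = X1%:~R + Y1%:~R * r1,
        v false true * v false false = X1%:~R - Y1%:~R * r1,
        v true true * v false true = X2%:~R + Y2%:~R * r2,
        v true false * v false false = X2%:~R - Y2%:~R * r2 &
        X1 = X2 + 2 * z].
  apply: (@biquad_relative_norms R p1 p2) => //.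
  - by case: (vw true true).
  - by case: (vw true false).
  - by case: (vw false true).
  - by case: (vw false false).
have [X1' [Y1' [X2' [Y2' [z' [h1' h2' h3' h4' _]]]]]] : exists X1 Y1 X2 Y2 z : int,
    [/\ w true true * w true false = X1%:~R + Y1%:~R * r1,
        w false true * w false false = X1%:~R - Y1%:~R * r1,
        w true true * w false true = X2%:~R + Y2%:~R * r2,
        w true false * w false false = X2%:~R - Y2%:~R * r2 &
        X1 = X2 + 2 * z].
  apply: (@biquad_relative_norms R p1 p2) => //.
  - by case: (vw true true).
  - by case: (vw true false).
  - by case: (vw false true).
  - by case: (vw false false).
have normE (p : nat) (r : R) (X Y : int) : r ^+ 2 = p%:R ->
    (X ^+ 2 - p%:Z * Y ^+ 2)%:~R = (X%:~R + Y%:~R * r) * (X%:~R - Y%:~R * r).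
  move=> rr; rewrite !expr2 !(intrB, intrM) -[(Posz p)%:~R]/(p%:R : R) -rr; ring.
have vw1 e1 e2 : v e1 e2 * w e1 e2 = 1 by case: (vw e1 e2).
have N1 : X1 ^+ 2 - p1%:Z * Y1 ^+ 2 = 1.
  have : (X1 ^+ 2 - p1%:Z * Y1 ^+ 2) * (X1' ^+ 2 - p1%:Z * Y1' ^+ 2) = 1.
    apply: (@intr_inj R); rewrite intrM !(normE _ _ _ _ r12) -h1 -h2 -h1' -h2'.
    rewrite -[RHS](_ : (v true true * w true true) * (v true false * w true false) *
      ((v false true * w false true) * (v false false * w false false)) = 1); first by ring.
    by rewrite !vw1 !mulr1.
  by move/mulz_eq1 => [//|/(norm_neqN1 p14)].
(* Both norms equal the product of all four conjugates. *)
have N2 : X2 ^+ 2 - p2%:Z * Y2 ^+ 2 = 1.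
  rewrite -N1; apply: (@intr_inj R).
  by rewrite (normE _ _ _ _ r12) (normE _ _ _ _ r22) -h1 -h2 -h3 -h4; ring.
have [k1 [z1 [k1E k1E' k1z]]] := pell_norm_logs r12 r10 p14 f1 ev1 N1.
have [k2 [z2 [k2E k2E' k2z]]] := pell_norm_logs r22 r20 p24 f2 ev2 N2.
have nz e1 e2 : v e1 e2 != 0.
  by apply/eqP => h; have /eqP := vw1 e1 e2; rewrite h mul0r eq_sym oner_eq0.
exists k1, k2, (z + z2 - z1); split.
- by rewrite -ln_normM // h1.
- by rewrite -ln_normM // h2.
- by rewrite -ln_normM // h3.
- by rewrite -ln_normM // h4.
- by lia.
Qed.

End UnitLogs.

(** * Orthogonal lattices *)

Section Lattices.
Variables (R : realType) (n : nat).
Implicit Types u v w : 'rV[R]_n.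

Lemma dotC u v : dot u v = dot v u.
Proof. by apply: eq_bigr => i _; rewrite mulrC. Qed.

Lemma dotZr u v (c : R) : dot u (c *: v) = c * dot u v.
Proof. by rewrite /dot mulr_sumr; apply: eq_bigr => i _; rewrite mxE mulrCA. Qed.

Lemma dotZl u v (c : R) : dot (c *: u) v = c * dot u v.
Proof. by rewrite dotC dotZr dotC. Qed.

Lemma dot_sumr m u (v : 'I_m -> 'rV[R]_n) (P : pred 'I_m) :
  dot u (\sum_(i | P i) v i) = \sum_(i | P i) dot u (v i).
Proof.
rewrite /dot [RHS]exchange_big; apply: eq_bigr => j _.
by rewrite summxE mulr_sumr.
Qed.

Lemma dot_eq0 u : dot u u = 0 -> u = 0.
Proof.
move=> /eqP; rewrite psumr_eq0 => [/allP h|i _]; last by rewrite -expr2 sqr_ge0.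
apply/rowP => i; rewrite mxE; have := h i (mem_index_enum i).
by rewrite -expr2 sqrf_eq0 => /eqP.
Qed.

(* As [L] is a lattice, [x] and [f - x] are lattice vectors summing to [f]. *)
Definition indecomposable (L : set 'rV[R]_n) (f : 'rV[R]_n) : Prop :=
  [/\ L f, f <> 0 & forall x, L x -> dot x (f - x) = 0 -> x = 0 \/ x = f].

(* Apply indecomposability to a nonzero component [c_i b_i] of [f]. *)
Lemma orthogonal_basis_indecomposable (m : nat) (L : set 'rV[R]_n) (B : 'M[R]_(m, n)) f :
    lattice_basis L B -> (forall i j : 'I_m, i != j -> dot (row i B) (row j B) = 0) ->
    indecomposable L f ->
  exists (i : 'I_m) (c : int), f = c%:~R *: row i B.
Proof.
move=> [_ LE] orth [Lf f0 find].
have [c cE] : exists c : 'I_m -> int, f = \sum_(i < m) (c i)%:~R *: row i B.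
  by move: Lf; rewrite LE.
have [i fi] : exists i, (c i)%:~R *: row i B <> 0.
  apply: contrapT => /forallNP h; apply: f0; rewrite cE big1 // => i _.
  by apply: contrapT; apply: h.
exists i, (c i); have [|//|//|->//] := find ((c i)%:~R *: row i B).
  rewrite LE; exists (fun j => if j == i then c i else 0).
  rewrite (bigD1 i) //= eqxx big1 ?addr0 // => j /negPf ->.
  by rewrite scale0r.
rewrite cE (bigD1 i) //= [X in X - _]addrC addrK dot_sumr big1 // => j ji.
by rewrite dotZl dotZr orth ?mulr0 // eq_sym.
Qed.

End Lattices.

(** * Explicit units and real embeddings *)

Section Units.
Variables (K : fieldExtType rat) (p1 p2 : nat) (s1 s2 : K).
Hypotheses (s1E : s1 ^+ 2 = p1%:R) (s2E : s2 ^+ 2 = p2%:R).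
Notation integral := (integralOver (intr : int -> K)).

Lemma integral_sqr (F : fieldType) (w : F) :
  integralOver (intr : int -> F) (w ^+ 2) -> integralOver (intr : int -> F) w.
Proof.
move=> i2; apply: (@integral_root_monic _ _ _ w ('X^2 - (w ^+ 2)%:P)).
- exact: monicXnsubC.
- by rewrite /root !hornerE subrr.
move=> _ /(nthP 0)[i _ <-]; rewrite coefB coefXn coefC.
apply: integral_sub; first exact: integral_nat.
by case: (i == 0%N) => //; apply: (integral_nat _ 0).
Qed.

(** This is [alpha_1 * alpha_2 / 2], a square root of [eps_1 * eps_2] for the chosen coefficients;
    negating [t'] conjugates it over [Q(s1)]. *)
Definition half_product (s t s' t' : int) : K :=
  (s%:~R + t%:~R * s1) * (s'%:~R + t'%:~R * s2) / 2.

Lemma natr_neq0 (n : nat) : (n.+1%:R : K) != 0.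
Proof. by rewrite -(rmorph_nat (in_alg K)) fmorph_eq0 pnatr_eq0. Qed.

(** Each factor squares to twice an element of [Z[sqrt p_i]], so the square of the half product is
    integral. *)
Lemma half_product_integral (s t s' t' e e' : int) :
    s ^+ 2 - p1%:Z * t ^+ 2 = 2 * e -> s' ^+ 2 - p2%:Z * t' ^+ 2 = 2 * e' ->
  integral (half_product s t s' t').
Proof.
move=> st st'; apply: integral_sqr.
have half (p : nat) (q : K) (a b c : int) : q ^+ 2 = p%:R ->
    a ^+ 2 - p%:Z * b ^+ 2 = 2 * c ->
  (a%:~R + b%:~R * q) ^+ 2 = 2 * ((c + p%:Z * b ^+ 2)%:~R + (a * b)%:~R * q).
  move=> qq ab.
  have -> : (a%:~R + b%:~R * q) ^+ 2 = (a ^+ 2)%:~R + b%:~R ^+ 2 * q ^+ 2 + 2 * (a * b)%:~R * q.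
    by rewrite expr2 !intrM; ring.
  have -> : a ^+ 2 = 2 * c + p%:Z * b ^+ 2 by rewrite -ab; ring.
  by rewrite qq expr2 !(intrD, intrM) -[(Posz p)%:~R]/(p%:R : K); ring.
rewrite /half_product !exprMn (half _ _ _ _ _ s1E st) (half _ _ _ _ _ s2E st').
set A := _ + _ * s1; set B := _ + _ * s2.
have -> : 2 * A * (2 * B) * 2^-1 ^+ 2 = A * B by field; rewrite ?natr_neq0.
have int z : integral z%:~R by apply: integral_id.
have ints (q : K) (p : nat) : q ^+ 2 = p%:R -> integral q.
  by move=> qq; apply: integral_sqr; rewrite qq; apply: integral_nat.
by apply: integral_mul; apply: integral_add; rewrite ?int //;
  apply: integral_mul; rewrite ?int //; [apply: ints s1E | apply: ints s2E].
Qed.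

(** Each factor times its conjugate is [2 e] or [2 e'], so the inverse is [e * e'] times the half
    product of the conjugates. *)
Lemma half_product_unit (s t s' t' e e' : int) :
    s ^+ 2 - p1%:Z * t ^+ 2 = 2 * e -> s' ^+ 2 - p2%:Z * t' ^+ 2 = 2 * e' ->
    e ^+ 2 = 1 -> e' ^+ 2 = 1 ->
  @integer_units K (half_product s t s' t').
Proof.
move=> st st' e1 e1'; split; first exact: half_product_integral st st'.
exists ((e * e')%:~R * half_product s (- t) s' (- t')).
  apply: integral_mul; first exact: integral_id.
  by apply: half_product_integral; rewrite sqrrN; [exact: st | exact: st'].
have norm (p : nat) (q : K) (a b c : int) : q ^+ 2 = p%:R ->
    a ^+ 2 - p%:Z * b ^+ 2 = 2 * c ->
  (a%:~R + b%:~R * q) * (a%:~R + (- b)%:~R * q) = 2 * c%:~R.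
  move=> qq ab; have := congr1 (fun z : int => z%:~R : K) ab.
  rewrite !expr2 !(intrB, intrM) -[(Posz p)%:~R]/(p%:R : K) -qq => h.
  by apply: etrans h; rewrite rmorphN; ring.
have n1 := norm _ _ _ _ _ s1E st; have n2 := norm _ _ _ _ _ s2E st'.
rewrite /half_product.
set A := _ + _ * s1 in n1 *; set B := _ + _ * s2 in n2 *.
set A' := _ + _ * s1 in n1 *; set B' := _ + _ * s2 in n2 *.
have -> : A * B / 2 * ((e * e')%:~R * (A' * B' / 2))
    = (e * e')%:~R * (A * A') * (B * B') / 2 ^+ 2 by field; rewrite ?natr_neq0.
rewrite n1 n2.
have -> : (e * e')%:~R * (2 * e%:~R) * (2 * e'%:~R) / 2 ^+ 2
  = (e ^+ 2 * e' ^+ 2)%:~R :> K.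
  by rewrite !expr2 !intrM; field; rewrite ?natr_neq0.
by rewrite e1 e1'.
Qed.

End Units.

Section Embeddings.
Variables (R : realType) (K : fieldExtType rat) (p1 p2 : nat) (s1 s2 : K) (r1 r2 : R).
Hypotheses (s1E : s1 ^+ 2 = p1%:R) (s2E : s2 ^+ 2 = p2%:R).
Hypotheses (r1E : r1 ^+ 2 = p1%:R) (r2E : r2 ^+ 2 = p2%:R) (r10 : 0 < r1) (r20 : 0 < r2).

Lemma embedding_biquad (f : {rmorphism K -> R}) (a b c d : rat) :
  f (in_alg K a + in_alg K b * s1 + in_alg K c * s2 + in_alg K d * (s1 * s2)) =
  biquad a b c d (f s1) (f s2).
Proof.
have fE q : f (in_alg K q) = ratr q by apply: (fmorph_eq_rat (f \o in_alg K)).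
by rewrite !(rmorphD, rmorphM) !fE.
Qed.

Lemma embedding_sign (f : {rmorphism K -> R}) (s : K) (p : nat) (r : R) :
  s ^+ 2 = p%:R -> r ^+ 2 = p%:R -> 0 < r -> f s = if 0 < f s then r else - r.
Proof.
move=> sE rE r0; have : (f s) ^+ 2 == r ^+ 2 by rewrite -rmorphXn sE rmorph_nat rE.
by rewrite eqf_sqr => /orP[] /eqP ->; rewrite ?r0 // oppr_gt0 ltNge ltW.
Qed.

Hypotheses (p1_prime : prime p1) (p2_prime : prime p2) (p1_neq_p2 : p1 <> p2).
Hypothesis gen : <<1 & [:: s1; s2]>>%VS = {:K}%VS.
Variable phi : 'I_(\dim {:K}) -> {rmorphism K -> R}.
Hypothesis phi_inj : forall i j, phi i =1 phi j -> i = j.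

(* Distinct embeddings have distinct signs on the two square roots; since there
   are at least four of them, every sign pattern occurs. *)
Lemma embeddings_by_signs : exists2 sigma : bool * bool -> 'I_(\dim {:K}),
  bijective sigma & forall e1 e2, phi (sigma (e1, e2)) s1 = (if e1 then r1 else - r1) /\
    phi (sigma (e1, e2)) s2 = (if e2 then r2 else - r2).
Proof.
pose sg i := (0 < phi i s1, 0 < phi i s2).
have sg_inj : injective sg.
  move=> i j [h1 h2]; apply: phi_inj => u.
  have [a [b [c [d ->]]]] := biquadratic_span s1E s2E u gen.
  rewrite !embedding_biquad; congr biquad.
    by rewrite (embedding_sign (phi i) s1E r1E r10) h1 -(embedding_sign (phi j) s1E r1E r10).
  by rewrite (embedding_sign (phi i) s2E r2E r20) h2 -(embedding_sign (phi j) s2E r2E r20).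
have [|sigma sgK sigmaK] := inj_card_bij sg_inj.
  by rewrite card_ord card_prod card_bool (biquadratic_dim s1E s2E).
exists sigma; first by exists sg.
move=> e1 e2; have := sigmaK (e1, e2); rewrite /sg => -[h1 h2].
by rewrite (embedding_sign _ s1E r1E r10) (embedding_sign _ s2E r2E r20) h1 h2.
Qed.

End Embeddings.

Lemma integral_embedding (R : realType) (K : fieldExtType rat) (f : {rmorphism K -> R}) (u : K) :
  integralOver (intr : int -> K) u -> integralOver (intr : int -> R) (f u).
Proof.
move/(integral_rmorph f) => [p pm pu]; exists p => //; move: pu.
by congr root; apply: eq_map_poly => z /=; rewrite rmorph_int.
Qed.

(** Squaring [y1 r1 - y2 r2 = x2 - x1] would make [2 y1 y2 r1 r2] an integer, though [p1 * p2] is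
    not a square. *)
Lemma fundamental_units_neq (R : realType) (p1 p2 : nat) (r1 r2 : R) (x1 y1 x2 y2 : int) :
    prime p1 -> prime p2 -> p1 <> p2 -> r1 ^+ 2 = p1%:R -> r2 ^+ 2 = p2%:R ->
    y1 <> 0 -> y2 <> 0 ->
  x1%:~R + y1%:~R * r1 <> x2%:~R + y2%:~R * r2.
Proof.
move=> pp1 pp2 np r1E r2E y10 y20 e.
have o12 : odd (logn p1 (p1 * p2)).
  by rewrite lognM ?prime_gt0 // !logn_prime // eqxx [p1 == p2](introF eqP np).
have e1 : y1%:~R * r1 - y2%:~R * r2 = (x2 - x1)%:~R by rewrite intrB; lra.
have e2 : 2 * y1%:~R * y2%:~R * (r1 * r2)
    = (p1%:Z * y1 ^+ 2 + p2%:Z * y2 ^+ 2 - (x2 - x1) ^+ 2)%:~R.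
  rewrite intrB [((x2 - x1) ^+ 2)%:~R]rmorphXn /= -e1 !expr2 !(intrD, intrM).
  by rewrite -![(Posz _)%:~R]/(_%:R : R) -r1E -r2E; ring.
have : (p1%:Z * y1 ^+ 2 + p2%:Z * y2 ^+ 2 - (x2 - x1) ^+ 2) ^+ 2
    = (p1 * p2)%N%:Z * (2 * y1 * y2) ^+ 2.
  apply: (@intr_inj R); rewrite rmorphXn /= -e2 PoszM !expr2 !intrM.
  by rewrite -![(Posz _)%:~R]/(_%:R : R) -r1E -r2E; ring.
by move/(odd_logn_nonsquare o12)/eqP; rewrite !mulf_eq0 /= => /orP[] /eqP.
Qed.

(** No integer lies strictly between 0 and [c]. *)
Lemma mulz_near_ge0 (k c : int) : c = 1 \/ c = -1 -> 0 <= k * (k - c).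
Proof. by case=> ->; have [h|h] := leP k 0; nia. Qed.

(** * Two indecomposable vectors and the failure of orthogonality *)

Theorem theorem1p2 (R : realType) (p1 p2 : nat)
    (p1_prime : prime p1) (p2_prime : prime p2) (p1_neq_p2 : p1 <> p2)
    (p1_mod4 : p1 = 3 %[mod 4]) (p2_mod4 : p2 = 3 %[mod 4])
    (K : fieldExtType rat) (sqrtp1 sqrtp2 : K)
    (sqrtp1E : sqrtp1 ^+ 2 = p1%:R) (sqrtp2E : sqrtp2 ^+ 2 = p2%:R)
    (K_gen : <<1 & [:: sqrtp1; sqrtp2]>>%VS = {:K}%VS)
    (phi : 'I_(\dim {:K}) -> {rmorphism K -> R})
    (phi_emb : real_embeddings phi) :
  ~ orthogonal_lattice (log_unit_lattice phi).
Proof.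
pose r1 : R := Num.sqrt p1%:R; pose r2 : R := Num.sqrt p2%:R.
have r1E : r1 ^+ 2 = p1%:R by rewrite sqr_sqrtr ?ler0n.
have r2E : r2 ^+ 2 = p2%:R by rewrite sqr_sqrtr ?ler0n.
have r10 : 0 < r1 by rewrite sqrtr_gt0 ltr0n prime_gt0.
have r20 : 0 < r2 by rewrite sqrtr_gt0 ltr0n prime_gt0.
have odd_logn p : prime p -> odd (logn p p) by move=> pp; rewrite logn_prime ?eqxx.
have [x1 [y1 f1]] := pell_fundamental_exists R (odd_logn_nonsquare (odd_logn _ p1_prime)).
have [x2 [y2 f2]] := pell_fundamental_exists R (odd_logn_nonsquare (odd_logn _ p2_prime)).
have [s1 [t1 [st1 stx1 sty1 ev1]]] := fundamental_twice_square p1_prime p1_mod4 f1.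
have [s2 [t2 [st2 stx2 sty2 ev2]]] := fundamental_twice_square p2_prime p2_mod4 f2.
have [x10 y10 _ _] := f1; have [x20 y20 _ _] := f2.
pose l1 := ln (x1%:~R + y1%:~R * r1); pose l2 := ln (x2%:~R + y2%:~R * r2).
have eps_gt1 (x y : int) (r : R) : 0 < x -> 0 < y -> 0 < r -> 1 < x%:~R + y%:~R * r.
  move=> x0 y0 r0; have h : 1 <= x%:~R :> R by rewrite ler1z -gtz0_ge1.
  have h' : 0 < y%:~R * r by rewrite mulr_gt0 ?ltr0z.
  by lra.
have e1 := eps_gt1 _ _ _ x10 y10 r10; have e2 := eps_gt1 _ _ _ x20 y20 r20.
have l10 : 0 < l1 by rewrite ln_gt0.
have l20 : 0 < l2 by rewrite ln_gt0.
have l12 : l1 <> l2.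
  move=> /ln_inj; rewrite !posrE => /(_ (lt_trans ltr01 e1) (lt_trans ltr01 e2)).
  apply: (fundamental_units_neq p1_prime p2_prime) => //; apply/eqP; exact: lt0r_neq0.
have [phi_inj _] := phi_emb.
have [sigma sigma_bij phiE] := embeddings_by_signs sqrtp1E sqrtp2E r1E r2E r10 r20
  p1_prime p2_prime p1_neq_p2 K_gen phi_inj.
pose q (v : 'rV[R]_(\dim {:K})) a b := v 0 (sigma (a, b)).
(* Coordinates in the orthonormal basis given by the four sign characters, with entries [1/2] and
   [-1/2]. *)
pose A0 v := (q v true true + q v true false + q v false true + q v false false) / 2.
pose A1 v := (q v true true + q v true false - q v false true - q v false false) / 2.
pose A2 v := (q v true true - q v true false + q v false true - q v false false) / 2.
pose A3 v := (q v true true - q v true false - q v false true + q v false false) / 2.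
have dotE u v : dot u v = A0 u * A0 v + A1 u * A1 v + A2 u * A2 v + A3 u * A3 v.
  rewrite /dot (reindex sigma) /=; last exact: onW_bij.
  have -> : \sum_b u 0 (sigma b) * v 0 (sigma b) = \sum_a \sum_b q u a b * q v a b.
    by rewrite pair_bigA; apply: eq_bigr => -[].
  by rewrite !big_bool /A0 /A1 /A2 /A3 /=; field.
have AB u v : [/\ A0 (u - v) = A0 u - A0 v, A1 (u - v) = A1 u - A1 v,
    A2 (u - v) = A2 u - A2 v & A3 (u - v) = A3 u - A3 v].
  by rewrite /A0 /A1 /A2 /A3 /q !mxE; split; field.
have A_eq0 v : A0 v = 0 -> A1 v = 0 -> A2 v = 0 -> A3 v = 0 -> v = 0.
  by move=> h0 h1 h2 h3; apply: dot_eq0; rewrite dotE h0 h1 h2 h3 !mul0r !addr0.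
set L := log_unit_lattice phi.
have L_logs x : L x -> exists k1 k2 z : int,
    [/\ A0 x = 0, A1 x = k1%:~R * l1, A2 x = k2%:~R * l2 & k1 = k2 + 2 * z].
  move=> [u [u_int [w w_int uw]] <-].
  have [a [b [c [d uE]]]] := biquadratic_span sqrtp1E sqrtp2E u K_gen.
  have [a' [b' [c' [d' wE]]]] := biquadratic_span sqrtp1E sqrtp2E w K_gen.
  have uphi e e' : phi (sigma (e, e')) u =
      biquad a b c d (if e then r1 else - r1) (if e' then r2 else - r2).
    by have [h1 h2] := phiE e e'; rewrite uE embedding_biquad h1 h2.
  have wphi e e' : phi (sigma (e, e')) w =
      biquad a' b' c' d' (if e then r1 else - r1) (if e' then r2 else - r2).
    by have [h1 h2] := phiE e e'; rewrite wE embedding_biquad h1 h2.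
  have [|k1 [k2 [z [h1 h2 h3 h4 h5]]]] := @unit_logs R p1 p2 r1 r2 x1 y1 x2 y2 a b c d a' b' c' d'
    p1_prime p2_prime p1_neq_p2 p1_mod4 p2_mod4 r1E r2E r10 r20 f1 ev1 f2 ev2.
    move=> e e'; rewrite -uphi -wphi; split; [exact: integral_embedding..|].
    by rewrite -rmorphM uw rmorph1.
  have qE e e' : q (Log phi u) e e' =
      ln `|biquad a b c d (if e then r1 else - r1) (if e' then r2 else - r2)|.
    by rewrite /q mxE uphi.
  rewrite -/l1 -/l2 in h1 h2 h3 h4.
  exists k1, k2, z; rewrite /A0 /A1 /A2 !qE; split => //; clear -h1 h2 h3 h4; lra.
(* [eta] selects the half product or its conjugate over [k_1]; the two terms [ln 2 / 2] cancel
   against the division by 2. *)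
have half_log (eta : bool) : exists f, [/\ L f, A0 f = 0, A1 f = l1,
    A2 f = (if eta then 1 else -1) * l2 & A3 f = 0].
  pose t2' := if eta then t2 else - t2.
  exists (Log phi (half_product sqrtp1 sqrtp2 s1 t1 s2 t2')).
  have half (p : nat) (s t : int) :
      s ^+ 2 - p%:Z * t ^+ 2 = 2 \/ s ^+ 2 - p%:Z * t ^+ 2 = -2 ->
    exists2 e : int, s ^+ 2 - p%:Z * t ^+ 2 = 2 * e & e ^+ 2 = 1.
    by case=> ->; [exists 1 | exists (-1)].
  have [c1 c1E c1u] := half _ _ _ st1.
  have [c2 c2E c2u] : exists2 e : int, s2 ^+ 2 - p2%:Z * t2' ^+ 2 = 2 * e & e ^+ 2 = 1.
    by apply: half; rewrite /t2'; case: (eta); rewrite ?sqrrN.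
  have [a1 a2 a3 a4] := twice_square_logs r1E r10 x10 y10 st1 stx1 sty1.
  have [b1 b2 b3 b4] := twice_square_logs r2E r20 x20 y20 st2 stx2 sty2.
  rewrite -/l1 in a1 a2; rewrite -/l2 in b1 b2.
  have qE e e' : q (Log phi (half_product sqrtp1 sqrtp2 s1 t1 s2 t2')) e e' =
     (if e then l1 else - l1) / 2 + (if e' == eta then l2 else - l2) / 2.
    have [h1 h2] := phiE e e'.
    rewrite /q mxE /half_product fmorph_div rmorph_nat rmorphM !rmorphD !rmorphM.
    rewrite !rmorph_int h1 h2.
    have -> : s1%:~R + t1%:~R * (if e then r1 else - r1) =
        if e then s1%:~R + t1%:~R * r1 else s1%:~R - t1%:~R * r1.
      by case: (e); rewrite ?mulrN.
    have -> : s2%:~R + t2'%:~R * (if e' then r2 else - r2) =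
        if e' == eta then s2%:~R + t2%:~R * r2 else s2%:~R - t2%:~R * r2.
      by rewrite /t2'; case: (e'); case: (eta); rewrite ?rmorphN ?mulrN ?mulNr ?opprK.
    have u0 : (if e then s1%:~R + t1%:~R * r1 else s1%:~R - t1%:~R * r1) != 0 by case: (e).
    have v0 : (if e' == eta then s2%:~R + t2%:~R * r2 else s2%:~R - t2%:~R * r2) != 0.
      by case: (e' == eta).
    rewrite ln_normM ?mulf_neq0 ?invr_eq0 // ln_normM // normfV.
    rewrite [`|2|]ger0_norm // lnV ?posrE //.
    by case: (e); case: (e' == eta); rewrite ?a1 ?a2 ?b1 ?b2; field.
  split.
  - exists (half_product sqrtp1 sqrtp2 s1 t1 s2 t2') => //.
    exact: (half_product_unit sqrtp1E sqrtp2E c1E c2E c1u c2u).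
  - by rewrite /A0 !qE; case: (eta) => /=; field.
  - by rewrite /A1 !qE; case: (eta) => /=; field.
  - by rewrite /A2 !qE; case: (eta) => /=; field.
  - by rewrite /A3 !qE; case: (eta) => /=; field.
have indec (eta : bool) f : L f -> A0 f = 0 -> A1 f = l1 ->
    A2 f = (if eta then 1 else -1) * l2 -> A3 f = 0 -> indecomposable L f.
  move=> Lf h0 h1 h2 h3; split=> //.
    move=> f0; move: h1; rewrite f0 /A1 /q !mxE => h; move: l10; rewrite -h; lra.
  move=> x Lx; have [k1 [k2 [z [g0 g1 g2 kz]]]] := L_logs x Lx.
  pose c : int := if eta then 1 else -1.
  have cE : (if eta then 1 else -1 : R) = c%:~R by rewrite /c; case: (eta).
  have c2 : c = 1 \/ c = -1 by rewrite /c; case: (eta); [left | right].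
  rewrite cE in h2.
  have [B0 B1 B2 B3] := AB f x.
  rewrite dotE B0 B1 B2 B3 h0 h1 h2 h3 g0 g1 g2 => dxf.
  have n1 : 0 <= k1 * (k1 - 1) by apply: mulz_near_ge0; left.
  have n2 : 0 <= k2 * (k2 - c) by apply: mulz_near_ge0.
  (* Orthogonality of [x] and [f - x] is a vanishing sum of three nonnegative terms, so [k1] is 0 or
     1, [k2] is 0 or [c], and [A3 x = 0]; the parity condition excludes the mixed cases. *)
  have dE : (k1 * (k1 - 1))%:~R * l1 ^+ 2 + (k2 * (k2 - c))%:~R * l2 ^+ 2 + A3 x ^+ 2 = 0.
    by rewrite -[RHS]oppr0 -dxf !(intrM, intrB); ring.
  have m1 : 0 <= (k1 * (k1 - 1))%:~R * l1 ^+ 2 by rewrite mulr_ge0 ?ler0z ?sqr_ge0.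
  have m2 : 0 <= (k2 * (k2 - c))%:~R * l2 ^+ 2 by rewrite mulr_ge0 ?ler0z ?sqr_ge0.
  have m3 : 0 <= A3 x ^+ 2 by rewrite sqr_ge0.
  move/eqP: dE; rewrite !paddr_eq0 ?addr_ge0 // => /andP[/andP[]].
  move=> + + /[!sqrf_eq0] /eqP x3.
  rewrite !mulf_eq0 !intr_eq0 !mulf_eq0 (gt_eqF l10) (gt_eqF l20) !orbF !subr_eq0.
  move=> /orP[] /eqP k1E /orP[] /eqP k2E.
  - left; apply: A_eq0 => //; first by rewrite g1 k1E mul0r.
    by rewrite g2 k2E mul0r.
  - by move: kz; rewrite k1E k2E; case: c2 => ->; clear; lia.
  - by move: kz; rewrite k1E k2E; clear; lia.
  - right; apply/esym/eqP; rewrite -subr_eq0; apply/eqP; apply: A_eq0.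
    + by rewrite B0 h0 g0 subrr.
    + by rewrite B1 h1 g1 k1E mul1r subrr.
    + by rewrite B2 h2 g2 k2E subrr.
    + by rewrite B3 h3 x3 subrr.
have [f [Lf f0 fA1 fA2 f3]] := half_log true.
have [g [Lg g0 gA1 gA2 g3]] := half_log false.
have indf := indec true f Lf f0 fA1 fA2 f3.
have indg := indec false g Lg g0 gA1 gA2 g3.
move=> [m [B basisB orthB]].
have [i [c fE]] := orthogonal_basis_indecomposable basisB orthB indf.
have [j [d gE]] := orthogonal_basis_indecomposable basisB orthB indg.
(* On a common basis vector, equal [A1] would force [f = g], against their opposite nonzero [A2]. On
   distinct ones, [dot f g = l1^2 - l2^2] would vanish, against [l12]. *)
have [ij|ij] := eqVneq i j.
  have AZ a v : A1 (a *: v) = a * A1 v /\ A2 (a *: v) = a * A2 v.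
    by rewrite /A1 /A2 /q !mxE; split; field.
  have [F1 F2] := AZ c%:~R (row i B); have [G1 G2] := AZ d%:~R (row i B).
  rewrite -fE fA1 fA2 in F1 F2; rewrite ij -gE -ij gA1 gA2 in G1 G2.
  have nz : A1 (row i B) != 0.
    by apply/eqP => h; move: l10; rewrite F1 h mulr0 ltxx.
  have cd : c%:~R = d%:~R :> R by apply: (mulIf nz); rewrite -F1.
  by move: l20; rewrite cd -G2 in F2; lra.
have : dot f g = 0 by rewrite fE gE dotZl dotZr orthB // !mulr0.
rewrite dotE f0 fA1 fA2 f3 g0 gA1 gA2 g3 => h.
have /eqP : l1 ^+ 2 = l2 ^+ 2 by lra.
by rewrite eqrXn2 ?ltW // => /eqP.
Qed.
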